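(* For every integer $k\geq 2$ there is a constant $C_k>0$ such that the following holds. Let $p=p(n)$ satisfy $p\geq C_k n^{-1}\log n$ and $n(1-p)\to\infty$ as $n\to\infty$. (i) If $k$ is even, then $\lim_{n\to\infty}\mathbb{P}\big(\chi'_k(G(2n,p))=k\big)=1$ and $\lim_{n\to\infty}\mathbb{P}\big(\chi'_k(G(2n+1,p))=k+1\big)=1$. (ii) If $k$ is odd, then $\lim_{n\to\infty}\mathbb{P}\big(\chi'_k(G(n,p))=k\big)=1$.
   Context: All graphs are simple. For an integer $k\geq 2$, a $\chi'_k$-coloring of a graph $G$ is a coloring of the edges of $G$ such that, for each color, the subgraph spanned by the edges of that color has all its degrees congruent to $1 \pmod k$ (i.e. every vertex incident to an edge of that color is incident to a number of edges of that color congruent to $1\pmod k$). The mod $k$ chromatic index $\chi'_k(G)$ is the minimum number of colors in a $\chi'_k$-coloring of $G$. $G(n,p)$ denotes the binomial random graph on $n$ vertices in which each pair is an edge independently with probability $p$. $\log$ is the natural logarithm. *)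

(* Defs.v *)
From mathcomp Require Import all_boot all_order all_algebra.
From mathcomp Require Import all_classical all_reals all_analysis.
Set Implicit Arguments.
Unset Strict Implicit.
Unset Printing Implicit Defensive.
Import Order.TTheory GRing.Theory Num.Theory.
Import numFieldNormedType.Exports.

Definition edge (T : finType) : finType := {e : {set T} | #|e| == 2}.

Definition sgraph (T : finType) := {set edge T}.

Definition degree (T : finType) (H : sgraph T) (v : T) : nat :=
  #|[set e in H | v \in val e]|.

Definition color_class (T : finType) (G : sgraph T) (c : edge T -> nat)
    (i : nat) : sgraph T :=
  [set e in G | c e == i].

Definition mod_coloring (k : nat) (T : finType) (G : sgraph T)
    (c : edge T -> nat) : Prop :=
  forall (i : nat) (v : T),
    degree (color_class G c i) v <> 0 ->
    degree (color_class G c i) v = 1 %[mod k].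

(* Only the values of [c] on the edges of [G] matter. *)
Definition mod_colorable (k : nat) (T : finType) (G : sgraph T)
    (m : nat) : Prop :=
  exists c : edge T -> nat,
    mod_coloring k G c /\ (forall e, e \in G -> c e < m).

Lemma mod_colorable_ex (k : nat) (T : finType) (G : sgraph T) :
  exists m, `[< mod_colorable k G m >].
Proof.
exists #|edge T|; apply/asboolP; exists (fun e => val (enum_rank e)).
split=> [i v|e _]; last exact: ltn_ord.
set H := color_class _ _ _ => degH_neq0; congr (_ %% k).
apply/eqP; rewrite eqn_leq lt0n; apply/andP; split; last exact/eqP.
apply/card_le1_eqP => e f; rewrite !inE.
move=> /andP[/andP[_ /eqP ei] _] /andP[/andP[_ /eqP fi] _].
by apply/enum_rank_inj/val_inj; rewrite /= ei fi.
Qed.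

Definition mod_chromatic_index (k : nat) (T : finType) (G : sgraph T) : nat :=
  ex_minn (mod_colorable_ex k G).

Local Open Scope ring_scope.

Definition gnp_mass (R : realType) (n : nat) (p : R) (G : sgraph 'I_n) : R :=
  \prod_(e : edge 'I_n) (if e \in G then p else 1 - p).

Definition gnp_prob (R : realType) (n : nat) (p : R)
    (A : pred (sgraph 'I_n)) : R :=
  \sum_(G : sgraph 'I_n | A G) gnp_mass p G.

(* Main.v *)
(* A vertex of degree divisible by k sees at least k colours, which gives the
   lower bound k. With k colours every vertex of degree 1 mod k sees exactly one
   colour; these vertices induce a connected graph and dominate, so one colour
   class spans all vertices with odd degrees when k is even, which is impossible
   if the number of vertices is odd. In that case one extra colour is enough: it
   is given to the star at a vertex of degree 1 mod k, and the rest of the graph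
   has an even number of vertices.

   For the upper bound, let S(v) be the first r colours, where r in {1, ..., k} is
   the degree of v mod k (with a few changes for parity when k is even), and
   colour uv from the intersection of S(u) and S(v). The number of colourings for
   which all degrees of colours i >= 1 are 1 mod k is, up to a factor, the sum over
   characters (a_(i,v)) of products over edges uv of
   sum_i zeta^(a_(i,u) + a_(i,v)). The characters with a_(i,v) = t_i, 2 t_i = 0,
   contribute the main term; any other character loses a constant factor on at
   least order n p edges for each exceptional value, by expansion, and
   n p >= C log n beats the number of characters. Degrees in colour 0 are then
   correct automatically.

   Expansion needs each vertex to have of order n p neighbours of each degree mod k:
   given the other edges, the degrees of vertices of U into a disjoint set W are
   independent binomial variables, and each residue has probability at least 8^-k. *)
Require Import Defs.
From mathcomp Require Import all_boot all_order all_algebra.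
From mathcomp Require Import all_classical all_reals all_analysis.
(* Listed last so that names shared with classical_sets mean finite sets. *)
From mathcomp Require Import fintype finset algC cyclotomic ring lra zify.
Import Order.TTheory GRing.Theory Num.Theory.
Import numFieldNormedType.Exports.
Local Open Scope ring_scope.

Set Implicit Arguments.
Unset Strict Implicit.
Unset Printing Implicit Defensive.

(** * Product measure on subsets *)

Section RandomSubset.
Context {R : realType} {E : finType} (p : R).
Hypothesis p01 : 0 <= p <= 1.
Implicit Types (F : {set E} -> R) (G : {set E}) (e : E) (s : seq E).

Definition subset_mass G : R := \prod_e (if e \in G then p else 1 - p).

Let p_ge0 : 0 <= p. Proof. by case/andP: p01. Qed.
Let q_ge0 : 0 <= 1 - p. Proof. by rewrite subr_ge0; case/andP: p01. Qed.

Definition expect F : R := \sum_(G : {set E}) subset_mass G * F G.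

Lemma subset_mass_ge0 G : 0 <= subset_mass G.
Proof. by apply: prodr_ge0 => e _; case: ifP. Qed.

Lemma expect_prod (a b : E -> R) :
  expect (fun G => \prod_e (if e \in G then a e else b e)) =
  \prod_e (p * a e + (1 - p) * b e).
Proof.
rewrite bigA_distr /expect; apply: eq_bigr => G _.
rewrite /subset_mass -big_split /=; apply: eq_bigr => e _.
by case: ifP.
Qed.

Lemma expect_cst (x : R) : expect (fun=> x) = x.
Proof.
rewrite /expect -mulr_suml; suff -> : \sum_G subset_mass G = 1 by rewrite mul1r.
have <- : \prod_(e : E) (p * 1 + (1 - p) * 1) = 1 by apply: big1 => e _; ring.
rewrite -expect_prod; apply: eq_bigr => G _.
by rewrite big1 ?mulr1 // => e _; case: ifP.
Qed.

Lemma eq_expect F1 F2 : F1 =1 F2 -> expect F1 = expect F2.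
Proof. by move=> eqF; apply: eq_bigr => G _; rewrite eqF. Qed.

Lemma le_expect F1 F2 : (forall G, F1 G <= F2 G) -> expect F1 <= expect F2.
Proof.
by move=> leF; apply: ler_sum => G _; rewrite ler_wpM2l ?subset_mass_ge0.
Qed.

Lemma expectZl (x : R) F : expect (fun G => x * F G) = x * expect F.
Proof. by rewrite /expect mulr_sumr; apply: eq_bigr => G _; rewrite mulrCA. Qed.

Lemma expectD F1 F2 : expect (fun G => F1 G + F2 G) = expect F1 + expect F2.
Proof. by rewrite -big_split; apply: eq_bigr => G _; rewrite mulrDr. Qed.

Lemma expect_sum (I : Type) (r : seq I) (P : pred I) (F : I -> {set E} -> R) :
  expect (fun G => \sum_(i <- r | P i) F i G) = \sum_(i <- r | P i) expect (F i).
Proof.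
by rewrite exchange_big; apply: eq_bigr => G _; rewrite mulr_sumr.
Qed.

(** The conditional expectation of [F] given [G] outside [e]. Its iterate [resample] averages over
    all elements of a list while the rest of [G] stays fixed. *)
Definition resample1 e F G : R := p * F (e |: G) + (1 - p) * F (G :\ e).

Lemma expect_resample1 e F : expect (resample1 e F) = expect F.
Proof.
have split_e (X : {set E} -> R) :
    \sum_(G : {set E}) X G = \sum_(G : {set E} | e \notin G) (X (e |: G) + X G).
  rewrite (bigID (fun G : {set E} => e \in G)) /= big_split; congr (_ + _).
  rewrite (reindex_onto (fun G => e |: G) (fun G => G :\ e)) /=.
    apply: eq_bigl => G; rewrite setU11 /=.
    apply/eqP/idP => [<-|eG]; last by rewrite setU1K.
    by rewrite !inE eqxx.
  by move=> G eG; rewrite setD1K.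
rewrite /expect !split_e; apply: eq_bigr => G eG.
have massE (b : bool) : subset_mass (if b then e |: G else G) =
    (if b then p else 1 - p) * \prod_(f | f != e) (if f \in G then p else 1 - p).
  rewrite /subset_mass (bigD1 e) //=; congr (_ * _).
    by case: b; rewrite ?setU11 // (negPf eG).
  by apply: eq_bigr => f fe; case: b; rewrite ?inE ?(negPf fe).
rewrite (massE true) (massE false) /resample1 setU1K //.
have -> : e |: (e |: G) = e |: G by apply/setUidPr; rewrite sub1set setU11.
have -> : G :\ e = G by apply/setDidPl; rewrite disjoint_sym disjoints1.
by ring.
Qed.

Definition resample s F := foldr resample1 F s.

Lemma expect_resample s F : expect (resample s F) = expect F.
Proof. by elim: s => //= e s <-; exact: expect_resample1. Qed.

(** The known-factor rule for conditional expectations: [X] does not depend on the resampled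
    elements. *)
Lemma resampleM s F X :
  (forall e G, e \in s -> X (e |: G) = X G /\ X (G :\ e) = X G) ->
  forall G, resample s (fun H => X H * F H) G = X G * resample s F G.
Proof.
elim: s => //= e s IHs Xind G; rewrite /resample1 !IHs => [|f H fs|f H fs].
- by have [-> ->] := Xind e G (mem_head _ _); ring.
- by apply: Xind; rewrite inE fs orbT.
- by apply: Xind; rewrite inE fs orbT.
Qed.

(** The expectation of [phi] at a binomial variable with [n] trials and success probability [p],
    expanded trial by trial so that it unfolds in step with [resample]. *)
Fixpoint binom_expect (n : nat) (phi : nat -> R) : R :=
  if n is n'.+1 then p * binom_expect n' (fun j => phi j.+1) +
                     (1 - p) * binom_expect n' phi
  else phi 0%N.

Lemma eq_binom_expect n (f g : nat -> R) : f =1 g ->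
  binom_expect n f = binom_expect n g.
Proof.
elim: n f g => /= [|n IHn] f g eqfg; first by rewrite eqfg.
by rewrite (IHn f g) // (IHn (fun j => f j.+1) (fun j => g j.+1)).
Qed.

(** Each element of [s] that is present raises [D] by exactly one, so [D] becomes its value with [s]
    removed plus a binomial count. *)
Lemma resample_binom s (D : {set E} -> nat) (phi : nat -> R) G : uniq s ->
  (forall e H, e \in s -> D (e |: H) = (D (H :\ e)).+1) ->
  resample s (fun H => phi (D H)) G =
  binom_expect (size s) (fun j => phi (j + D (G :\: [set e in s]))%N).
Proof.
elim: s G => [|e s IHs] G /=.
  by move=> _ _; rewrite -[in LHS](setD0 G); congr (phi (D _)); apply/setP=> f; rewrite !inE.
case/andP=> es us HD; rewrite /resample1 !IHs //; last first.
- by move=> f H fs; apply: HD; rewrite inE fs orbT.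
- by move=> f H fs; apply: HD; rewrite inE fs orbT.
have eqH : (G :\ e) :\: [set f in s] = G :\: [set f in e :: s].
  by apply/setP => f; rewrite !inE negb_or; do !case: eqP; rewrite //= ?andbF ?andbT // => *; rewrite andbA.
rewrite eqH; congr (_ * _ + _); apply: eq_binom_expect => j.
congr (phi _); rewrite addSnnS; congr (_ + _)%N.
have -> : (e |: G) :\: [set f in s] = e |: (G :\: [set f in e :: s]).
  apply/setP => f; rewrite !inE negb_or; have [->|fe] := eqVneq f e; first by rewrite es.
  by [].
rewrite HD ?mem_head //; congr (D _).+1.
by apply/setP => f; rewrite !inE negb_or; case: eqP.
Qed.

Lemma le_binom_expect n (f g : nat -> R) : (forall j, f j <= g j) ->
  binom_expect n f <= binom_expect n g.
Proof.
elim: n f g => //= n IHn f g lefg.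
by apply: lerD; apply: ler_wpM2l => //; exact: IHn.
Qed.

Lemma binom_expect_cst n (x : R) : binom_expect n (fun=> x) = x.
Proof. by elim: n => //= n IHn; rewrite IHn; ring. Qed.

Lemma binom_expectD m n f :
  binom_expect (m + n) f =
  binom_expect m (fun i => binom_expect n (fun j => f (i + j)%N)).
Proof. by elim: m f => //= m IHm f; rewrite !IHm. Qed.

Lemma binom_expect_ge0 n f : (forall j, 0 <= f j) -> 0 <= binom_expect n f.
Proof. by move=> f0; rewrite -(binom_expect_cst n 0); exact: le_binom_expect. Qed.

Lemma binom_expect_none n f : (forall j, 0 <= f j) ->
  (1 - p) ^+ n * f 0%N <= binom_expect n f.
Proof.
elim: n f => [|n IHn] f f0 /=; first by rewrite expr0 mul1r.
rewrite exprS -mulrA -[leLHS]add0r lerD //.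
  by rewrite mulr_ge0 ?binom_expect_ge0.
by rewrite ler_wpM2l ?IHn.
Qed.

Lemma binom_expect_one n f : (forall j, 0 <= f j) ->
  n%:R * p * (1 - p) ^+ n.-1 * f 1%N <= binom_expect n f.
Proof.
elim: n f => [|n IHn] f f0 /=; first by rewrite !mul0r.
have -> : n.+1%:R * p * (1 - p) ^+ n * f 1%N =
    p * ((1 - p) ^+ n * f 1%N) + (1 - p) * (n%:R * p * (1 - p) ^+ n.-1 * f 1%N).
  case: n {IHn} => [|n] /=; first by rewrite !expr0; ring.
  by rewrite exprS -!natr1; ring.
by apply: lerD; apply: ler_wpM2l => //; first [exact: binom_expect_none | exact: IHn].
Qed.

End RandomSubset.

(** * Residues of binomial variables modulo k *)

Section BinomialResidue.
Context {R : realType}.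
Implicit Types (p : R) (f g : nat -> R).

Lemma binom_expect_rev p n f :
  binom_expect p n f = binom_expect (1 - p) n (fun j => f (n - j)%N).
Proof.
have eq_le q m g h : (forall j, (j <= m)%N -> g j = h j) ->
    binom_expect q m g = binom_expect q m h.
  elim: m g h => /= [|m IHm] g h eqgh; first by rewrite eqgh.
  rewrite (IHm g h) ?(IHm (fun j => g j.+1) (fun j => h j.+1)) // => j jm.
    by rewrite eqgh.
  by rewrite eqgh // ltnW.
elim: n f => [|n IHn] f //=.
rewrite (IHn f) (IHn (fun j => f j.+1)) addrC.
congr (_ * _ + _); first by rewrite subKr; congr (_ * _); apply: eq_le => j jn; rewrite subSn.
Qed.

Lemma bernoulli_sub p n : 0 <= p <= 1 -> 1 - n%:R * p <= (1 - p) ^+ n.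
Proof.
case/andP => p0 p1; elim: n => [|n IHn]; first by rewrite mul0r subr0 expr0.
rewrite exprS -natr1; have := ler_wpM2l (_ : 0 <= 1 - p) IHn.
rewrite subr_ge0 => /(_ p1); apply: le_trans.
by have := ler0n R n; nra.
Qed.

(** With [L] about 1/(2p) trials the mean [L * p] lies between 1/4 and 1/2. Then no success has
    probability at least 1/2, and exactly one success has probability at least 1/4 * 1/2 = 1/8. *)
Lemma binom_block p : 0 < p <= 2^-1 ->
  exists L : nat, L%:R * p <= 2^-1 /\ forall (i : bool) f, (forall j, 0 <= f j) ->
    f i <= 8 * binom_expect p L f.
Proof.
case/andP => p0 p12; pose L := Num.truncn ((2 * p)^-1); exists L.
have pL1 : L%:R * p <= 2^-1.
  have : L%:R <= (2 * p)^-1 by rewrite truncn_le invr_ge0; lra.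
  rewrite -(ler_pM2r p0) => /le_trans; apply; rewrite invfM -mulrA mulVf ?mulr1 //.
  by rewrite gt_eqF.
have L0 : (0 < L)%N.
  by rewrite truncn_gt0 invf_ge1; lra.
have pL2 : 4^-1 <= L%:R * p.
  have [p14|p14] := lerP p 4^-1.
    have : (2 * p)^-1 < L.+1%:R by exact: truncnS_gt.
    rewrite -(ltr_pM2r p0) invfM -mulrA mulVf ?mulr1 ?gt_eqF // -[L.+1%:R]natr1 => ?; lra.
  have : 1 <= L%:R :> R by rewrite ler1n.
  by nra.
have p01 : 0 <= p <= 1 by apply/andP; split; lra.
split=> // i f f0; case: i => /=.
  have := binom_expect_one p01 L f0; have := f0 1%N.
  have : 2^-1 <= (1 - p) ^+ L.-1.
    apply: le_trans (bernoulli_sub L.-1 p01).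
    have : L.-1%:R <= L%:R :> R by rewrite ler_nat leq_pred.
    by nra.
  set y := _ ^+ _ => y12; move: (f 1%N) => z z0; rewrite -mulrA.
  have : 8^-1 <= L%:R * p * y by nra.
  by rewrite mulrA; move: (L%:R * p * y) => w; nra.
have := binom_expect_none p01 L f0; have := f0 0%N.
have := bernoulli_sub L p01; move: (_ ^+ _) => y; nra.
Qed.

(** For [p > 1/2] failures are counted instead, so the two likely values are [L - 1] and [L] rather
    than 0 and 1; hence the shift [a]. *)
Lemma binom_block_shift p : 0 < p < 1 ->
  exists (L a : nat), (L%:R * p <= 2^-1 \/ L%:R * (1 - p) <= 2^-1) /\
    forall (i : bool) f, (forall j, 0 <= f j) ->
    f (a + i)%N <= 8 * binom_expect p L f.
Proof.
case/andP => p0 p1; have [p12|p12] := lerP p 2^-1.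
  by case: (@binom_block p) => [|L [H1 H2]]; [rewrite p0|exists L, 0%N; split; [left|]].
case: (@binom_block (1 - p)) => [|L [H1 H2]]; first by apply/andP; split; lra.
exists L, L.-1; split; [by right|move=> i f f0].
have -> : f (L.-1 + i)%N = f (L - ~~ i)%N.
  (* The empty block is excluded, since it never takes the value 1. *)
  case: L H2 {H1} => [|L] H2.
    have /= := H2 true (fun j => (j == 1%N)%:R) (fun=> ler0n _ _).
    by rewrite mulr0 ler10.
  by case: i; rewrite ?addn0 ?addn1 ?subn0 ?subn1.
rewrite binom_expect_rev; exact: (H2 (~~ i) (fun j => f (L - j)%N)).
Qed.

(** Each of [k] disjoint blocks takes each of the values [a] and [a + 1] with probability at least
    1/8. Together they reach any [k * a + i] with [i <= k] with probability at least 8^-k, which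
    covers all residues whatever the other trials give. *)
Lemma binom_expect_residue (k N : nat) p (x r : nat) : (0 < k)%N -> 0 < p < 1 ->
  k%:R <= 2 * N%:R * p -> k%:R <= 2 * N%:R * (1 - p) ->
  8^-1 ^+ k <= binom_expect p N (fun j => (j + x == r %[mod k])%N%:R).
Proof.
move=> k0 p01 Np Nq; have [L [a [HL blk]]] := binom_block_shift p01.
have p01' : 0 <= p <= 1 by case/andP: p01 => ? ?; rewrite !ltW.
have iter_blk j : forall (i : nat) f, (i <= j)%N -> (forall n, 0 <= f n) ->
    f (j * a + i)%N <= 8 ^+ j * binom_expect p (j * L) f.
  elim: j => [|j IHj] i f ij f0.
    by move: ij; rewrite leqn0 => /eqP ->; rewrite !mul0n expr0 mul1r.
  have -> : (j.+1 * a + i = (a + (0 < i)%N) + (j * a + i.-1))%N by case: i {ij} => *; lia.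
  have -> : (j.+1 * L = L + j * L)%N by lia.
  rewrite binom_expectD exprSr -mulrA.
  apply: le_trans (IHj i.-1 (fun m => f (a + (0 < i)%N + m)%N) _ _) _ => //; first by lia.
  rewrite ler_pM2l ?exprn_gt0 //; apply: (blk _ (fun m => binom_expect p (j * L) (fun l => f (m + l)%N))).
  by move=> m; exact: binom_expect_ge0.
have kLN : (k * L <= N)%N.
  rewrite -(ler_nat R) natrM; case/andP: p01 => p0 p1.
  case: HL => HL.
    by rewrite -(ler_pM2r p0) -mulrA; have := ler_wpM2l (ler0n R k) HL; lra.
  have q0 : 0 < 1 - p by lra.
  by rewrite -(ler_pM2r q0) -mulrA; have := ler_wpM2l (ler0n R k) HL; lra.
(* The trials outside the blocks are fixed first: [m] is their number of successes, and [i] is the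
   correction that the blocks must supply. *)
rewrite -(subnK kLN) binom_expectD -[leLHS](binom_expect_cst p (N - k * L)).
apply: le_binom_expect => // m.
pose y := (k * a + m + x)%N; pose i := ((r + (k - y %% k)) %% k)%N.
have ik : (i < k)%N by rewrite ltn_mod.
have eq_r : (m + (k * a + i) + x == r %[mod k])%N.
  have -> : (m + (k * a + i) + x = i + y)%N by rewrite /y; lia.
  rewrite /i modnDml -modnDmr -addnA subnK ?modnDr //.
  by rewrite ltnW // ltn_mod.
have := iter_blk k i (fun j => (m + j + x == r %[mod k])%N%:R) (ltnW ik) (fun=> ler0n _ _).
rewrite eq_r exprVn -ler_pdivrMl ?exprn_gt0 // mulr1; exact.
Qed.

End BinomialResidue.

(** * Expanders *)

Section Expanders.
Local Open Scope nat_scope.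
Context {T : finType}.
Implicit Types (e : edge T) (H : sgraph T) (S A B J W : {set T}) (u v : T).

Lemma edgeP e : exists x y, x != y /\ val e = [set x; y].
Proof. by have /cards2P[x [y [xy exy]]] := valP e; exists x, y. Qed.

Definition cross A B e := ~~ [disjoint val e & A] && ~~ [disjoint val e & B].

Lemma crossP A B e : [disjoint A & B] ->
  reflect (exists x y, [/\ x \in A, y \in B & val e = [set x; y]]) (cross A B e).
Proof.
move=> dAB; apply: (iffP andP) => [[]|[x [y [xA yB exy]]]].
  case/pred0Pn => x /andP[/= xe xA] /pred0Pn[y /andP[/= ye yB]].
  exists x, y; split=> //; apply/eqP; rewrite eq_sym eqEcard (eqP (valP e)).
  have xy : x != y by apply: contraTneq xA => ->; rewrite (disjointFl dAB).
  by rewrite cards2 xy subUset !sub1set xe ye.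
by split; apply/pred0Pn; [exists x|exists y]; rewrite /= exy ?set21 ?set22.
Qed.

(** The edges from [v] to [P]. The end in [P] must differ from [v] because [v] may itself belong to
    [P]. *)
Definition joined H v (P : {set T}) : {set edge T} :=
  [set e in H | (v \in val e) && [exists u in val e, (u != v) && (u \in P)]].

(** The degrees from [S] into the union of [S] and [J] add up to at least [4 * m * #|S|]. Edges
    inside [S] count twice and account for at most half of this; the rest must cross to [J]. *)
Lemma small_cut H S J m : [disjoint S & J] ->
  #|[set e in H | val e \subset S]| <= m * #|S| ->
  (forall v, v \in S -> 4 * m <= #|joined H v (S :|: J)|) ->
  2 * m * #|S| <= #|[set e in H | cross S J e]|.
Proof.
move=> dSJ sparse deg.
have le_sum : \sum_(v in S) #|joined H v (S :|: J)| <=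
    \sum_(e in H) (2 * (val e \subset S) + cross S J e).
  under eq_bigr => v _ do rewrite -sum1_card.
  rewrite (exchange_big_dep (mem H)) /=; last by move=> v e _; rewrite inE => /andP[].
  apply: leq_sum => e eH; rewrite sum1_card.
  have [x [y [xy exy]]] := edgeP e.
  case: (boolP (val e \subset S)) => eS.
    apply: leq_trans (leq_addr _ _); apply: leq_trans (eq_leq (eqP (valP e))).
    by apply: subset_leq_card; apply/subsetP => v; rewrite unfold_in inE => /and4P[].
  rewrite muln0 add0n; case: (boolP (cross _ _ _)) => [_|nc].
    rewrite leqNgt; apply: contraNN eS => /card_gt1P[v [w [vP wP vw]]].
    move: vP; rewrite unfold_in inE => /and4P[vS _ ve _].
    move: wP; rewrite unfold_in inE => /and4P[wS _ we _].
    have -> : val e = [set v; w].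
      by apply/eqP; rewrite eq_sym eqEcard (eqP (valP e)) cards2 vw subUset !sub1set ve we.
    by rewrite subUset !sub1set vS.
  rewrite leqn0; apply/eqP/eq_card0 => v; rewrite [LHS]unfold_in inE.
  apply/negbTE/negP => /and4P[vS _ ve /existsP[u /and3P[ue uv uSJ]]].
  have evu : val e = [set v; u].
    by apply/eqP; rewrite eq_sym eqEcard (eqP (valP e)) cards2 eq_sym uv subUset !sub1set ve ue.
  move: uSJ; rewrite inE => /orP[uS|uJ].
    by move: eS; rewrite evu subUset !sub1set vS uS.
  by case/negP: nc; apply/crossP => //; exists v, u.
have : \sum_(v in S) 4 * m <= \sum_(e in H) (2 * (val e \subset S) + cross S J e).
  by apply: leq_trans le_sum; apply: leq_sum.
rewrite sum_nat_const big_split /= -big_distrr /=.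
have toC (P : pred (edge T)) : \sum_(e in H) P e = #|[set e in H | P e]|.
  rewrite -sum1_card big_mkcond [RHS]big_mkcond; apply: eq_bigr => e _.
  by rewrite inE; case: (e \in H) => //; case: (P e).
rewrite (toC (fun e => val e \subset S)) toC; move: sparse; move: #|[set e in H | cross S J e]| => c; nia.
Qed.

Definition residue_class k H (Vs : {set T}) r : {set T} :=
  [set v in Vs | degree H v == r %[mod k]].

(* In G(n, p), [m] and [d] are of order n p, while [h] and [h'] are of order n. *)
Record expander k H (Vs : {set T}) (m d h h' : nat) : Prop := {
  expander_edge : forall e, e \in H -> val e \subset Vs;
  expander_joined : forall v r, v \in Vs -> r < k ->
    4 * m <= #|joined H v (residue_class k H Vs r)|;
  expander_sparse : forall S, S \subset Vs -> #|S| <= h ->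
    #|[set e in H | val e \subset S]| <= m * #|S|;
  expander_cross : forall A B, A \subset Vs -> B \subset Vs -> [disjoint A & B] ->
    h' <= #|A| -> h' <= #|B| -> 2 * k * d * #|T| <= #|[set e in H | cross A B e]|;
  expander_params : [/\ 0 < d, k * d <= m, k <= h & 2 * k * h' <= h] }.

Section ExpanderTheory.
Variables (k : nat) (H : sgraph T) (Vs : {set T}) (m d h h' : nat).
Hypotheses (k1 : 1 < k) (expH : expander k H Vs m d h h').
Local Notation Q := (residue_class k H Vs).

Lemma expander_m_gt0 : 0 < m.
Proof. by have [d0 kdm _ _] := expander_params expH; nia. Qed.

Lemma joinedS v A B : A \subset B -> #|joined H v A| <= #|joined H v B|.
Proof.
move=> AB; apply: subset_leq_card; apply/subsetP => e; rewrite !inE.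
case/and3P=> -> -> /existsP[u /and3P[ue uv uA]]; apply/existsP; exists u.
by rewrite ue uv (subsetP AB).
Qed.

(** Otherwise [small_cut] with [J] empty would produce edges from [Q r] to the empty set. *)
Lemma residue_class_large r : Vs != set0 -> r < k -> h < #|Q r|.
Proof.
case/set0Pn => v vVs rk; rewrite ltnNge; apply/negP => Qh.
have QVs : Q r \subset Vs by apply/subsetP => u; rewrite inE => /andP[].
have m0 := expander_m_gt0.
have [u uQ] : exists u, u \in Q r.
  have := expander_joined expH vVs rk; rewrite leqNgt.
  case: (set_0Vmem (joined H v (Q r))) => [->|[e]]; first by rewrite cards0 muln_gt0 m0.
  by rewrite inE => /and3P[_ _ /existsP[u /and3P[_ _ uQ]]] _; exists u.
have := @small_cut H (Q r) set0 m _ (expander_sparse expH QVs Qh).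
rewrite -setI_eq0 setI0 eqxx setU0 => /(_ isT).
have -> : [set e in H | cross (Q r) set0 e] = set0.
  by apply/setP => e; rewrite !inE /cross -[X in _ && ~~ X]setI_eq0 setI0 eqxx !andbF.
rewrite cards0 leqn0 !muln_eq0 /= => H1.
have /H1 /orP[/eqP m00|/eqP Q0] : forall w, w \in Q r -> 4 * m <= #|joined H w (Q r)|.
    by move=> w /(subsetP QVs) wVs; exact: (expander_joined expH).
  by rewrite m00 in m0.
by rewrite (cards0_eq Q0) inE in uQ.
Qed.

(** If one side has at most [h] vertices, [small_cut] applies to it, as its vertices have many
    neighbours in [Q r]; if both are larger, [expander_cross] applies. *)
Lemma residue_class_connected r A B : r < k -> A :|: B = Q r -> [disjoint A & B] ->
  A != set0 -> B != set0 -> exists2 e, e \in H & cross A B e.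
Proof.
move=> rk ABQ dAB A0 B0.
suff [e] : exists e, e \in [set e in H | cross A B e].
  by rewrite inE => /andP[eH ec]; exists e.
apply/set0Pn; rewrite -card_gt0.
have QVs : Q r \subset Vs by apply/subsetP => u; rewrite inE => /andP[].
have AVs : A \subset Vs by apply: subset_trans QVs; rewrite -ABQ subsetUl.
have BVs : B \subset Vs by apply: subset_trans QVs; rewrite -ABQ subsetUr.
have [d0 kdm _ hh] := expander_params expH; have m0 := expander_m_gt0.
have deg v : v \in Q r -> 4 * m <= #|joined H v (Q r)|.
  by move=> /(subsetP QVs) vVs; exact: (expander_joined expH).
have [Ah|Ah] := leqP #|A| h.
  have := @small_cut H A B m dAB (expander_sparse expH AVs Ah).
  rewrite ABQ => cut; apply: leq_trans (cut _) => [|v vA].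
    by rewrite !muln_gt0 m0 card_gt0.
  by apply: deg; rewrite -ABQ inE vA.
have [Bh|Bh] := leqP #|B| h.
  have := @small_cut H B A m _ (expander_sparse expH BVs Bh).
  rewrite disjoint_sym setUC ABQ => /(_ dAB) cut.
  have -> : [set e in H | cross A B e] = [set e in H | cross B A e].
    by apply/setP => e; rewrite !inE /cross [X in _ && X]andbC.
  apply: leq_trans (cut _) => [|v vB].
    by rewrite !muln_gt0 m0 card_gt0.
  by apply: deg; rewrite -ABQ inE vB orbT.
apply: leq_trans (expander_cross expH AVs BVs dAB _ _); [|nia|nia].
rewrite !muln_gt0 d0 (ltnW k1) /=; case/set0Pn: A0 => x _.
by apply/card_gt0P; exists x.
Qed.

(** The expansion estimate for one colour: [W] is the set of vertices that may use it and [f] is its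
    part of the character. If a frequent value [j] satisfies [2 * j = 0] mod [k], an edge from a
    vertex of value [j] to one of another value has nonzero sum. Otherwise the edges inside the
    class of [j] already have nonzero sum. *)
Lemma expander_label (W : {set T}) (f : T -> 'I_k) : Vs != set0 ->
  Q 0 \subset W -> W \subset Vs ->
  exists t : 'I_k, k %| 2 * t /\
    2 * k * d * #|[set v in W | f v != t]| <=
    #|[set e in H | (val e \subset W) && ~~ (k %| \sum_(v in val e) f v)]|.
Proof.
move=> Vs0 QW WVs; have [d0 kdm _ hh] := expander_params expH.
pose J (j : 'I_k) := [set v in W | f v == j].
have [j Jj] : exists j, #|W| <= k * #|J j|.
  apply/existsP; apply: contraT; rewrite negb_exists => /forallP small.
  have : \sum_(j < k) k * #|J j| <= \sum_(j < k) #|W|.-1.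
    by apply: leq_sum => j _; have := small j; lia.
  have -> : \sum_(j < k) k * #|J j| = k * #|W|.
    rewrite -big_distrr /=; congr (_ * _).
    rewrite -[RHS]sum1_card (partition_big f xpredT) //=; apply: eq_bigr => j _.
    by rewrite -sum1_card; apply: eq_bigl => v; rewrite inE.
  have := small (Ordinal (ltnW k1)).
  by rewrite sum_nat_const card_ord; nia.
have Wh : h < #|W|.
  by apply: leq_trans (subset_leq_card QW); exact/residue_class_large/ltnW.
have Jh : 2 * h' < #|J j|.
  by have := leq_ltn_trans hh (leq_trans Wh Jj); nia.
have JW : J j \subset W by apply/subsetP => v; rewrite inE => /andP[].
have JVs := subset_trans JW WVs.
case: (boolP (k %| 2 * j)) => kj.
  exists j; split=> //; set S := [set v in W | _].
  have SW : S \subset W by apply/subsetP => v; rewrite inE => /andP[].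
  have SVs := subset_trans SW WVs.
  have dSJ : [disjoint S & J j].
    by rewrite disjoint_subset; apply/subsetP => v; rewrite !inE => /andP[-> /negPf->].
  have SJ : S :|: J j = W.
    by apply/setP => v; rewrite !inE; case: (v \in W) => //=; rewrite orNb.
  suff cut : 2 * k * d * #|S| <= #|[set e in H | cross S (J j) e]|.
    apply: leq_trans cut _; apply: subset_leq_card; apply/subsetP => e.
    rewrite !inE => /andP[-> /(crossP _ dSJ)[x [y [xS yJ exy]]]] /=.
    have yx : x != y by apply: contraTneq xS => ->; rewrite (disjointFl dSJ).
    rewrite exy subUset !sub1set (subsetP SW x xS) (subsetP JW y yJ) /=.
    rewrite big_setU1 ?inE //= big_set1.
    move: yJ; rewrite inE => /andP[_ /eqP ->]; move: xS; rewrite inE => /andP[_].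
    apply: contraNN => kfj; apply/eqP/val_inj => /=.
    have : f x + j == j + j %[mod k] by rewrite addnn -mul2n (eqP kj) (eqP kfj).
    by rewrite eqn_modDr !modn_small // => /eqP.
  (* A small [S] expands because its vertices have many neighbours in [Q 0], which lies in [W]; a
     large one by [expander_cross], with [#|S| <= #|T|]. *)
  have [Sh|Sh] := leqP #|S| h.
    apply: leq_trans (@small_cut H S (J j) m dSJ (expander_sparse expH SVs Sh) _).
      by nia.
    move=> v vS; rewrite SJ; apply: leq_trans (joinedS _ QW).
    by apply: (expander_joined expH); [exact: (subsetP SVs)|lia].
  apply: leq_trans (expander_cross expH SVs JVs dSJ _ _); [|nia|nia].
  by rewrite leq_mul2l max_card orbT.
(* Here [t = 0] will do: even if all vertices are exceptional, the edges between two parts of [J j],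
   each of size at least [h'], are numerous enough. *)
exists (Ordinal (ltnW k1)); split; first by rewrite muln0 dvdn0.
pose A : {set T} := [set v in take h' (enum (J j))].
have AJ : A \subset J j.
  by apply/subsetP => v; rewrite inE => /mem_take; rewrite mem_enum.
have cA : #|A| = h'.
  rewrite cardsE; have /card_uniqP -> : uniq (take h' (enum (J j))).
    by rewrite take_uniq ?enum_uniq.
  by rewrite size_takel // -cardE; lia.
have cB : h' <= #|J j :\: A| by rewrite cardsDS // cA; lia.
have dAB : [disjoint A & J j :\: A].
  by rewrite disjoint_sym disjoints_subset subsetDr.
apply: leq_trans (leq_trans (expander_cross expH (subset_trans AJ JVs)
   (subset_trans (subsetDl _ _) JVs) dAB _ cB) _); [|by rewrite cA|].
  by rewrite leq_mul2l max_card orbT.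
apply: subset_leq_card; apply/subsetP => e.
rewrite !inE => /andP[-> /(crossP _ dAB)[x [y [xA yB exy]]]] /=.
have yx : x != y by apply: contraTneq xA => ->; rewrite (disjointFl dAB).
have xJ := subsetP AJ x xA; have yJ : y \in J j by move: yB; rewrite inE => /andP[].
rewrite exy subUset !sub1set (subsetP JW x xJ) (subsetP JW y yJ) /=.
rewrite big_setU1 ?inE //= big_set1; move: xJ yJ; rewrite !inE.
by case/andP=> _ /eqP -> /andP[_ /eqP ->]; rewrite addnn -mul2n.
Qed.

End ExpanderTheory.
End Expanders.

(** * Character sums *)

(** This is the bound 1/(1 - ny) for (1 + y)^n, multiplied out so that the sign of 1 - ny does not
    matter. It serves both algebraic and real numbers. *)
Lemma exprD1_mulB_le1 (F : numFieldType) (y : F) n :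
  0 <= y -> (1 + y) ^+ n * (1 - n%:R * y) <= 1.
Proof.
move=> y0; elim: n => [|n IHn]; first by rewrite expr0 mul0r subr0 mulr1.
apply: le_trans IHn; rewrite exprSr -mulrA ler_wpM2l ?exprn_ge0 ?addr_ge0 //.
have -> : (1 + y) * (1 - n.+1%:R * y) = 1 - n%:R * y - n.+1%:R * y ^+ 2.
  by rewrite -natr1; ring.
by rewrite gerBl mulr_ge0 // exprn_ge0.
Qed.

Lemma exprD1_le2 (F : numFieldType) (y : F) n :
  0 <= y -> n%:R * y <= 2^-1 -> (1 + y) ^+ n <= 2.
Proof.
move=> y0 ny; rewrite -[2]mul1r -ler_pdivrMr //.
apply: le_trans (exprD1_mulB_le1 n y0); rewrite ler_wpM2l ?exprn_ge0 ?addr_ge0 //.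
by rewrite lerBrDl -lerBrDr; apply: le_trans ny _; rewrite [X in _ <= X - _](splitr 1) mul1r addrK.
Qed.

(** Equality in the triangle inequality for [1 + z ^+ j] would force [z ^+ j = 1]. As only finitely
    many residues [j] occur, one gap serves for all; an integer [K] lets later size conditions be
    stated in [nat]. *)
Lemma unity_root_gap k : (0 < k)%N -> exists (z : algC) (K : nat),
  [/\ k.-primitive_root z, (1 < K)%N &
   forall j, ~~ (k %| j)%N -> `|1 + z ^+ j| <= 2 - k%:R / K%:R].
Proof.
move=> k0; have [z zk] := C_prim_root_exists k0.
have gap (j : 'I_k) : exists K : nat, (0 < K)%N /\
    (~~ (k %| j)%N -> `|1 + z ^+ j| <= 2 - k%:R / K%:R).
  case: (boolP (k %| j)%N) => kj; first by exists 1%N.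
  have norm1 : `|z ^+ j| = 1.
    apply/eqP; rewrite -(@pexpr_eq1 _ _ k) // -normrX exprAC (prim_expr_order zk).
    by rewrite expr1n normr1.
  have lt2 : `|1 + z ^+ j| < 2.
    rewrite lt_neqAle andbC; apply/andP; split.
      by apply: le_trans (ler_normD _ _) _; rewrite norm1 normr1.
    apply: contraNneq kj => eq2.
    have : `|1 + z ^+ j| = `|1| + `|z ^+ j| by rewrite norm1 normr1 eq2.
    move=> /normCDeq[t _]; rewrite norm1 normr1 !mul1r => -[<- zj1].
    by rewrite (prim_order_dvd zk) zj1.
  have g0 : 0 < 2 - `|1 + z ^+ j| by rewrite subr_gt0.
  pose K := Num.bound (k%:R / (2 - `|1 + z ^+ j|)).
  have KP : k%:R / (2 - `|1 + z ^+ j|) < K%:R.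
    by apply: archi_boundP; rewrite divr_ge0 // ltW.
  have K0 : (0 < K)%N.
    by rewrite -(ltr_nat algC); apply: le_lt_trans KP; rewrite divr_ge0 // ltW.
  exists K; split=> // _; rewrite lerBrDl -lerBrDr ler_pdivrMr ?ltr0n // mulrC.
  by rewrite -ler_pdivrMr // ltW.
have [f fP] := choice gap.
(* The sum dominates the constant of each residue, and the 2 ensures [1 < K]. *)
exists z, (2 + \sum_j f j)%N; split=> // j kj.
have jk : (j %% k < k)%N by rewrite ltn_mod.
rewrite -(prim_expr_mod zk); have [K0 ] := fP (Ordinal jk).
rewrite /= /dvdn modn_mod => /(_ kj)/le_trans; apply.
rewrite lerD2l lerN2 ler_wpM2l // lef_pV2 ?qualifE /= ?ltr0n // ler_nat.
by rewrite (bigD1 (Ordinal jk)) //=; lia.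
Qed.

Section CharacterSum.
Variables (k0 : nat) (T : finType) (H : sgraph T).
Local Notation k := k0.+2.
Variable S : T -> {set 'I_k}.
Implicit Types (e : edge T) (v : T) (i j : 'I_k) (a : {ffun 'I_k * T -> 'I_k})
  (c : {ffun edge T -> 'I_k}).

(* Colour 0 carries no constraint: once the others are right, the congruence
   #|S v| = degree v forces it. *)
Definition active (x : 'I_k * T) := (x.1 != ord0) && (x.1 \in S x.2).

(** Pairs outside [H] are forced to colour 0, so that a colouring can be a total function on pairs
    without adding any freedom. *)
Definition allowed e : {set 'I_k} :=
  if e \in H then [set i | [forall v in val e, i \in S v]] else [set ord0].

Definition colour_degree c i v := #|[set e in H | (v \in val e) && (c e == i)]|.

Definition edge_weight a e i : nat :=
  if e \in H then (\sum_(v in val e) a (i, v))%N else 0%N.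

(** A character has one exponent for each active pair (colour, vertex); the exponents at inactive
    pairs are pinned to 0. *)
Definition label x : pred 'I_k := [pred b | active x || (b == ord0)].

Hypothesis S0 : forall e v, e \in H -> v \in val e -> ord0 \in S v.
Hypothesis parity : forall i (t : 'I_k), i != ord0 -> (k %| 2 * t)%N ->
  (k %| t * #|[set v | i \in S v]|)%N.
Variable d : nat.
Hypothesis expand : forall i (f : T -> 'I_k), i != ord0 ->
  exists t : 'I_k, (k %| 2 * t)%N /\
  (2 * k * d * #|[set v | (i \in S v) && (f v != t)]| <=
   #|[set e in H | (val e \subset [set v | i \in S v]) &&
       ~~ (k %| \sum_(v in val e) f v)]|)%N.

(** Double counting of incidences. The summand [k.-1] plays the role of -1: the constraint is that
    each colour degree minus one vanishes mod [k]. *)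
Lemma sum_weight a c :
  (\sum_x a x * (colour_degree c x.1 x.2 + k.-1) =
   k.-1 * (\sum_x a x) + \sum_e edge_weight a e (c e))%N.
Proof.
rewrite big_distrr /= [RHS]addnC.
under eq_bigr => x _ do rewrite mulnDr [(a x * k.-1)%N]mulnC.
rewrite big_split /=; congr (_ + _)%N.
transitivity (\sum_x \sum_(e in H) a x * ((x.2 \in val e) && (c e == x.1)))%N.
  apply: eq_bigr => x _; rewrite /colour_degree -sum1_card big_distrr /=.
  rewrite big_mkcond [RHS]big_mkcond; apply: eq_bigr => e _.
  by rewrite inE; case: (e \in H) => //=; case: (_ && _); rewrite ?muln0 ?muln1.
rewrite exchange_big [RHS](bigID (mem H)) /= [X in (_ + X)%N]big1 ?addn0; last first.
  by move=> e /negPf eH; rewrite /edge_weight eH.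
apply: eq_bigr => e eH; rewrite /edge_weight eH.
transitivity (\sum_i \sum_v a (i, v) * ((v \in val e) && (c e == i)))%N.
  by rewrite pair_bigA; apply: eq_bigr => -[].
rewrite (bigD1 (c e)) //= [X in (_ + X)%N]big1 ?addn0; last first.
  by move=> i ie; rewrite big1 // => v _; rewrite eq_sym (negPf ie) andbF muln0.
rewrite [RHS]big_mkcond; apply: eq_bigr => v _.
by rewrite eqxx andbT; case: (v \in val e); rewrite ?muln1 ?muln0.
Qed.

Section Root.
Variables (z : algC) (K : nat).
Hypotheses (zk : k.-primitive_root z) (K1 : (1 < K)%N).
Hypothesis gap : forall n : nat, ~~ (k %| n)%N -> `|1 + z ^+ n| <= 2 - k%:R / K%:R.

(** The sum over all allowed colourings of the character [a] at the vector of colour degrees minus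
    one, in the form that factors over the edges. *)
Definition char_sum a : algC :=
  z ^+ (k.-1 * (\sum_x a x)) * \prod_e \sum_(i in allowed e) z ^+ edge_weight a e i.

(** Orthogonality of characters: for a fixed colouring, a violated constraint at [x] makes the sum
    over [a x] a geometric sum of a nontrivial root of unity, which is zero. *)
Lemma sum_char_sum_eq0 :
  (forall c, c \in family allowed -> exists x, active x /\
     ~~ (k %| colour_degree c x.1 x.2 + k.-1)%N) ->
  \sum_(a in family label) char_sum a = 0.
Proof.
move=> none.
transitivity (\sum_(a in family label) \sum_(c in family allowed)
    \prod_x z ^+ (a x * (colour_degree c x.1 x.2 + k.-1))).
  apply: eq_bigr => a _; rewrite /char_sum bigA_distr_big_dep mulr_sumr.
  apply: eq_bigr => c _.
  by rewrite !prodrXr -exprD sum_weight.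
rewrite exchange_big big1 // => c /none[x [actx kx]].
rewrite -(bigA_distr_big_dep label
   (fun x (b : 'I_k) => z ^+ (b * (colour_degree c x.1 x.2 + k.-1)))) /=.
rewrite (bigD1 x) //= [X in X * _](_ : _ = 0) ?mul0r //.
set y := (_ + _)%N in kx *.
rewrite (eq_bigl xpredT) => [|b]; last by rewrite /label /= actx.
have zy1 : z ^+ y != 1 by rewrite -(prim_order_dvd zk).
under eq_bigr => b _ do rewrite mulnC exprM.
apply: (@mulfI _ (z ^+ y - 1)); first by rewrite subr_eq0.
by rewrite mulr0 -subrX1 -exprM mulnC exprM (prim_expr_order zk) expr1n subrr.
Qed.

Lemma normz (n : nat) : `|z ^+ n| = 1.
Proof.
apply/eqP; rewrite -(@pexpr_eq1 _ _ k) // -normrX exprAC (prim_expr_order zk).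
by rewrite expr1n normr1.
Qed.

Definition num_allowed : algC := \prod_e #|allowed e|%:R.

Lemma ord0_allowed e : ord0 \in allowed e.
Proof.
rewrite /allowed; case: ifP => eH; rewrite inE //.
by apply/forallP => v; apply/implyP; exact: S0.
Qed.

Lemma num_allowed_gt0 : 0 < num_allowed.
Proof.
apply: prodr_gt0 => e _; rewrite ltr0n; apply/card_gt0P; exists ord0.
exact: ord0_allowed.
Qed.

Definition bad a : {set edge T} :=
  [set e in H | [exists i in allowed e, ~~ (k %| edge_weight a e i)%N]].

Lemma edge_weight0 a e : a \in family label -> edge_weight a e ord0 = 0%N.
Proof.
move=> /familyP aQ; rewrite /edge_weight; case: ifP => // _.
rewrite big1 // => v _; have := aQ (ord0, v).
by rewrite !inE /active /= => /eqP ->.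
Qed.

(** At a bad edge colour 0 contributes 1 and some other allowed colour a root of unity different
    from 1. By [gap] the edge sum loses [k / K], hence at least the fraction 1/K of its at most [k]
    terms. *)
Lemma norm_char_sum a : a \in family label ->
  `|char_sum a| <= num_allowed * (1 - K%:R^-1) ^+ #|bad a|.
Proof.
move=> aQ; rewrite /char_sum normrM normz mul1r normr_prod.
rewrite -prodr_const [X in _ * X]big_mkcond -big_split /=.
apply: ler_prod => e _; rewrite normr_ge0 /=.
have norm_le (A : {set 'I_k}) : `|\sum_(i in A) z ^+ edge_weight a e i| <= #|A|%:R.
  apply: le_trans (ler_norm_sum _ _ _) _.
  by rewrite (eq_bigr (fun=> 1)) => [|i _]; rewrite ?sumr_const ?normz.
case: ifP => [|_]; last by rewrite mulr1 norm_le.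
rewrite inE => /andP[eH /existsP[i /andP[iL ki]]].
have i0 : i != ord0 by apply: contraNneq ki => ->; rewrite edge_weight0.
rewrite (bigD1 ord0) ?ord0_allowed //= (bigD1 i) ?iL //= edge_weight0 // expr0 addrA.
pose B := [set j in allowed e | (j != ord0) && (j != i)].
rewrite (eq_bigl (mem B)) => [|j]; last by rewrite !inE andbA.
have cardL : #|allowed e| = (2 + #|B|)%N.
  rewrite (cardD1 ord0) ord0_allowed [X in (true + X)%N](cardD1 i) !inE i0 iL.
  rewrite !addSn !add0n; congr _.+2.
  by apply: eq_card => j; rewrite !inE andbCA [RHS]andbC andbA.
rewrite cardL; apply: le_trans (ler_normD _ _) _; apply: le_trans (lerD (gap ki) (norm_le B)) _.
rewrite mulrBr mulr1 natrD addrAC lerD2l lerN2 ler_wpM2r ?invr_ge0 //.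
by rewrite -natrD ler_nat -cardL -[leqRHS](card_ord k) max_card.
Qed.

Definition exceptions a (t : {ffun 'I_k -> 'I_k}) :=
  [set x | active x && (a x != t x.1)].

(** Every edge exponent is [2 * t i] or 0, hence trivial, and [parity] makes the leading factor
    trivial as well. *)
Lemma char_sum_trivial a (t : {ffun 'I_k -> 'I_k}) : a \in family label ->
  (forall i, k %| 2 * t i)%N -> exceptions a t = set0 -> char_sum a = num_allowed.
Proof.
move=> aQ t2 exc0.
have at_ x : active x -> a x = t x.1.
  move=> actx; apply/eqP; apply: contraT => ax.
  by have := in_set0 x; rewrite -exc0 inE actx ax.
have a0 x : ~~ active x -> a x = ord0.
  by move=> /negPf nact; have /familyP/(_ x) := aQ; rewrite !inE nact => /eqP.
rewrite /char_sum; have -> : z ^+ (k.-1 * \sum_x a x) = 1.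
  apply/eqP; rewrite -(prim_order_dvd zk) dvdn_mull //.
  have -> : (\sum_x a x = \sum_i \sum_v a (i, v))%N.
    by rewrite pair_bigA; apply: eq_bigr => -[].
  apply: dvdn_sum => i _.
  have [-> | i0] := eqVneq i ord0.
    by rewrite big1 // => v _; rewrite a0 // /active eqxx.
  have -> : (\sum_v a (i, v) = t i * #|[set v | i \in S v]|)%N.
    rewrite mulnC -sum_nat_const [RHS]big_mkcond; apply: eq_bigr => v _.
    rewrite inE; case: ifP => iS; first by rewrite at_ // /active /= i0.
    by rewrite a0 // /active /= iS andbF.
  exact: parity.
rewrite mul1r; apply: eq_bigr => e _.
rewrite (eq_bigr (fun=> 1)) ?sumr_const // => i iL.
apply/eqP; rewrite -(prim_order_dvd zk).
have [-> | i0] := eqVneq i ord0; first by rewrite edge_weight0.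
rewrite /edge_weight; case: ifP => // eH.
move: iL; rewrite /allowed eH inE => /forallP iL.
rewrite (eq_bigr (fun=> t i : nat)) => [|v ve].
  by rewrite sum_nat_const (eqP (valP e)).
by rewrite at_ // /active /= i0; exact: (implyP (iL v)).
Qed.

(** [expand] bounds the exceptions of each colour against the same set of bad edges; adding over the
    [k] colours costs the factor [k] built into [expand]. *)
Lemma few_exceptions a : a \in family label ->
  exists t : {ffun 'I_k -> 'I_k}, (forall i, k %| 2 * t i)%N /\
    (2 * d * #|exceptions a t| <= #|bad a|)%N.
Proof.
move=> aQ.
have /choice[t tP] i : exists t : 'I_k, (k %| 2 * t)%N /\
    (2 * k * d * #|[set v | (i != ord0) && (i \in S v) && (a (i, v) != t)]| <= #|bad a|)%N.
  have [-> | i0] := eqVneq i ord0.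
    exists ord0; split; first by rewrite muln0 dvdn0.
    by rewrite eq_card0 ?muln0 // => v; rewrite !inE.
  have [t [t2 le_t]] := expand (fun v => a (i, v)) i0; exists t; split=> //.
  apply: leq_trans le_t _; apply/subset_leq_card/subsetP => e.
  rewrite !inE => /and3P[eH eS ke]; rewrite eH; apply/existsP; exists i.
  rewrite /edge_weight /allowed eH ke inE andbT; apply/forallP => v.
  by apply/implyP => /(subsetP eS); rewrite inE.
exists [ffun i => t i]; split=> [i|]; first by rewrite ffunE; case: (tP i).
have : (\sum_(i : 'I_k) 2 * k * d *
     #|[set v | (i != ord0) && (i \in S v) && (a (i, v) != t i)]| <=
     \sum_(i : 'I_k) #|bad a|)%N by apply: leq_sum => i _; case: (tP i).
rewrite -big_distrr sum_nat_const card_ord /=.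
have -> : (\sum_i #|[set v | (i != ord0) && (i \in S v) && (a (i, v) != t i)]| =
           #|exceptions a [ffun i => t i]|)%N.
  rewrite -[RHS]sum1_card [RHS]big_mkcond /=.
  transitivity (\sum_i \sum_v ((i, v) \in exceptions a [ffun i => t i]))%N.
    apply: eq_bigr => i _; rewrite -sum1_card [LHS]big_mkcond; apply: eq_bigr => v _.
    by rewrite !inE /active /= ffunE; case: (_ && _).
  rewrite pair_bigA; apply: eq_bigr => -[i v] _ /=.
  by case: (_ \in _).
move: #|exceptions _ _| #|bad a| => E B.
by rewrite [(2 * k)%N]mulnC -!mulnA leq_pmul2l // mulnA.
Qed.

Hypothesis size_bound : (2 * k ^ k.+2 * #|T|.+1 * K.-1 ^ d < K ^ d)%N.

(** If no colouring worked, all character sums would add up to zero. Each trivial character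
    contributes [num_allowed], while the nontrivial ones together contribute less than that in
    norm. *)
Lemma exists_colouring : exists c, c \in family allowed /\
  forall x, active x -> (k %| colour_degree c x.1 x.2 + k.-1)%N.
Proof.
apply: contrapT => none.
have all_bad c : c \in family allowed -> exists x, active x /\
     ~~ (k %| colour_degree c x.1 x.2 + k.-1)%N.
  move=> cL; apply: contrapT => no_x; apply: none; exists c; split=> // x actx.
  by apply: contrapT => kx; apply: no_x; exists x; split=> //; apply/negP.
have /eqP := sum_char_sum_eq0 all_bad.
pose r : algC := 1 - K%:R^-1; pose x := r ^+ d.
have K0 : 0 < K%:R :> algC by rewrite ltr0n ltnW.
have r0 : 0 <= r by rewrite subr_ge0 invf_le1 // ler1n ltnW.
have r1 : r <= 1 by rewrite gerBl invr_ge0 ltW.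
have x0 : 0 <= x by rewrite exprn_ge0.
have x1 : x <= 1 by rewrite exprn_ile1.
pose y (t : {ffun 'I_k -> 'I_k}) w (b : 'I_k) : algC :=
  if active w && (b != t w.1) then x else 1.
have y0 t w b : 0 <= y t w b by rewrite /y; case: ifP.
pose nontrivial a := [forall t : {ffun 'I_k -> 'I_k},
  [forall i, (k %| 2 * t i)%N] ==> (exceptions a t != set0)].
have xk : (2 * k ^ k.+2 * #|T|.+1)%N%:R * x < 1.
  have -> : x = (K.-1 ^ d)%N%:R / (K ^ d)%N%:R.
    rewrite !natrX -expr_div_n; congr (_ ^+ d); rewrite /r -subn1 natrB ?(ltnW K1) //.
    by rewrite mulrBl mul1r divff // gt_eqF.
  by rewrite mulrA -natrM ltr_pdivrMr ?ltr0n ?expn_gt0 ?(ltnW K1) // mul1r ltr_nat.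
have bound : \sum_(a in family label | nontrivial a) r ^+ #|bad a| < 1.
  have prodE a t : \prod_w y t w (a w) = x ^+ #|exceptions a t|.
    rewrite -prodr_const [RHS]big_mkcond; apply: eq_bigr => w _.
    by rewrite inE.
  (* With [E >= 1] exceptions, [r ^+ #|bad a|] is at most [x ^+ (2 * E)], hence at most
     [x * x ^+ E]. Summing over all [t] gives a bound that factors over the pairs [w]; the spare [x]
     pays for the number of choices of [t]. *)
  apply: (@le_lt_trans _ _ (\sum_(a in family label)
      \sum_(t : {ffun 'I_k -> 'I_k}) x * \prod_w y t w (a w))).
    rewrite [leRHS](bigID nontrivial) /= -[leLHS]addr0; apply: lerD; last first.
      by do 2!(apply: sumr_ge0 => ? _); rewrite mulr_ge0 // prodr_ge0.
    apply: ler_sum => a /andP[aL /forallP nta].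
    have [t [t2 few]] := few_exceptions aL.
    have exc0 : (0 < #|exceptions a t|)%N.
      by rewrite card_gt0; apply: (implyP (nta t)); apply/forallP.
    rewrite (bigD1 t) //= prodE -[leLHS]addr0; apply: lerD; last first.
      by apply: sumr_ge0 => ? _; rewrite mulr_ge0 // prodr_ge0.
    apply: (@le_trans _ _ (r ^+ (2 * d * #|exceptions a t|))).
      by apply: ler_wiXn2l; rewrite ?r0 ?r1.
    rewrite mulnAC mulnC exprM -/x mul2n -addnn exprD ler_wpM2r ?exprn_ge0 //.
    by rewrite -[leRHS]expr1; apply: ler_wiXn2l; rewrite ?x0 ?x1.
  rewrite exchange_big /=.
  apply: (@le_lt_trans _ _ (\sum_(t : {ffun 'I_k -> 'I_k}) x * 2)).
    apply: ler_sum => t _; rewrite -mulr_sumr ler_wpM2l //.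
    rewrite -(bigA_distr_big_dep label (y t)).
    (* For each pair, the value [t w.1] has weight 1 and each of the other values weight [x]. *)
    apply: (@le_trans _ _ (\prod_(w : 'I_k * T) (1 + k%:R * x))).
      apply: ler_prod => w _; rewrite sumr_ge0 //=.
      case: (boolP (active w)) => actw; last first.
        rewrite (big_pred1 ord0) => [|b]; last by rewrite /label /= (negPf actw).
        by rewrite /y (negPf actw) lerDl mulr_ge0.
      apply: (@le_trans _ _ (\sum_b y t w b)).
        rewrite [leRHS](bigID (fun b => b \in label w)) /= lerDl.
        by apply: sumr_ge0.
      rewrite (bigD1 (t w.1)) //= {1}/y eqxx andbF lerD2l.
      apply: (@le_trans _ _ (\sum_(b : 'I_k) x)).
        rewrite [leRHS](bigD1 (t w.1)) //= -[leLHS]add0r lerD //.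
        by apply: ler_sum => b bt; rewrite /y actw bt.
      by rewrite sumr_const card_ord mulr_natl.
    rewrite prodr_const card_prod card_ord exprD1_le2 ?mulr_ge0 //.
    rewrite -[leRHS]mul1r ler_pdivlMr // ltW //; apply: le_lt_trans xk.
    rewrite mulrA -natrM mulrAC -natrM ler_wpM2r // ler_nat.
    rewrite [(k ^ k.+2)%N]expnS [(k ^ k.+1)%N]expnS.
    have : (0 < k ^ k)%N by rewrite expn_gt0.
    move: (k ^ k)%N k #|T| => u v n u0.
    apply: (@leq_trans (2 * (v * (v * 1)) * n.+1)%N); first by nia.
    by rewrite leq_mul2r !leq_mul2l u0 !orbT.
  rewrite sumr_const card_ffun card_ord -[ltLHS]mulr_natl mulrA mulrAC -natrM.
  apply: le_lt_trans xk; rewrite ler_wpM2r // ler_nat.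
  rewrite [(k ^ k.+2)%N]expnS [(k ^ k.+1)%N]expnS.
  by move: (k ^ k)%N => u; nia.
have trivP a : a \in family label -> ~~ nontrivial a -> char_sum a = num_allowed.
  move=> aL; rewrite negb_forall => /existsP[t].
  rewrite negb_imply negbK => /andP[/forallP t2 /eqP exc0].
  exact: char_sum_trivial exc0.
rewrite (bigID nontrivial) /= addrC addr_eq0 => /eqP eq_sum.
have : `|\sum_(a in family label | nontrivial a) char_sum a| < num_allowed.
  apply: le_lt_trans (ler_norm_sum _ _ _) _.
  rewrite -(ltr_pM2l num_allowed_gt0) mulr1 in bound; apply: le_lt_trans bound.
  by rewrite mulr_sumr; apply: ler_sum => a /andP[aL _]; exact: norm_char_sum.
rewrite -normrN -eq_sum (eq_bigr (fun=> num_allowed)) => [|a /andP[aL]]; last exact: trivP.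
rewrite sumr_const normrMn ger0_norm ?(ltW num_allowed_gt0) // => /lt_geF/negP; apply.
rewrite -[leLHS]mulr1n ler_pMn2l ?num_allowed_gt0 //.
(* The zero character is trivial, so at least one term [num_allowed] occurs. *)
apply/card_gt0P; exists [ffun=> ord0]; rewrite unfold_in /=; apply/andP; split.
  by apply/familyP => w; rewrite ffunE !inE eqxx orbT.
rewrite negb_forall; apply/existsP; exists [ffun=> ord0].
rewrite negb_imply negbK; apply/andP; split.
  by apply/forallP => i; rewrite ffunE muln0 dvdn0.
by apply/eqP/setP => w; rewrite !inE !ffunE eqxx andbF.
Qed.
End Root.
End CharacterSum.

(** * Colour lists *)

Section UpperBound.
Local Open Scope nat_scope.
Variables (k0 : nat) (T : finType) (H : sgraph T) (Vs : {set T}).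
Local Notation k := k0.+2.
Local Notation Q := (residue_class k H Vs).
Implicit Types (v : T) (i : 'I_k) (S : T -> {set 'I_k}).

(** [lists_full] puts [Q 0] into the support of every colour, as the expansion estimate demands.
    [lists_parity] handles [t = k / 2], the nonzero solution of [2 * t = 0] mod [k] for even [k]. *)
Record colour_lists S : Prop := {
  lists_out : forall v, v \notin Vs -> S v = set0;
  lists_ord0 : forall v, v \in Vs -> ord0 \in S v;
  lists_card : forall v, v \in Vs -> #|S v| = degree H v %[mod k];
  lists_full : forall v, v \in Q 0 -> S v = [set: 'I_k];
  lists_parity : ~~ odd k -> forall i, i != ord0 -> ~~ odd #|[set v | i \in S v]| }.

Hypothesis sub_Vs : forall e, e \in H -> val e \subset Vs.

Lemma degree_out v : v \notin Vs -> degree H v = 0.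
Proof.
move=> vVs; apply: eq_card0 => e; rewrite !inE.
by apply/negP => /andP[/sub_Vs/subsetP/(_ v) sv /sv]; rewrite (negPf vVs).
Qed.

Lemma sum_degree : \sum_v degree H v = 2 * #|H|.
Proof.
transitivity (\sum_v \sum_(e in H) (v \in val e)).
  apply: eq_bigr => v _; rewrite /degree -sum1_card big_mkcond [RHS]big_mkcond.
  by apply: eq_bigr => e _; rewrite inE; case: (e \in H); case: (v \in _).
rewrite exchange_big /= mulnC -sum_nat_const; apply: eq_bigr => e _.
transitivity #|val e|; last exact/eqP/(valP e).
rewrite -sum1_card [RHS]big_mkcond; apply: eq_bigr => v _.
by case: (v \in _).
Qed.

(** The degree minus one mod [k], so that the list of colours 0, ..., [residue v] has between 1 and
    [k] elements and is full when [k] divides the degree. *)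
Definition residue v := (degree H v + k.-1) %% k.

Lemma residueP v : residue v < k /\ (residue v).+1 = degree H v %[mod k].
Proof.
split; first by rewrite ltn_mod.
by rewrite -addn1 /residue modnDml -addnA addn1 /= modnDr.
Qed.

Definition nested_list v : {set 'I_k} :=
  if v \in Vs then [set i : 'I_k | i <= residue v] else set0.

Lemma card_nested_list v : v \in Vs -> #|nested_list v| = (residue v).+1.
Proof.
move=> vVs; rewrite /nested_list vVs.
have [rk _] := residueP v.
rewrite -sum1dep_card -[RHS]card_ord -[RHS]sum1_card.
by rewrite (big_ord_widen k (fun=> 1)).
Qed.

Lemma nested_lists_odd : odd k -> colour_lists nested_list.
Proof.
move=> ok; split=> [v|v|v|v|]; last by rewrite ok.
- by rewrite /nested_list => /negPf->.
- by rewrite /nested_list => ->; rewrite inE.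
- by move=> vVs; rewrite card_nested_list //; case: (residueP v).
rewrite inE => /andP[vVs /eqP dv]; apply/setP => i; rewrite /nested_list vVs !inE.
have -> : residue v = k.-1 by rewrite /residue -modnDml dv mod0n add0n modn_small.
by rewrite -ltnS ltn_ord.
Qed.

(* Some vertices of residue 2 trade colour 1 for a colour [j >= 2] that lies on
   an odd number of nested lists; colour 1 is then settled by the handshake. *)
Definition swapped v j := [&& v \in Q 2, index v (enum (Q 2)) == j, 2 <= j < k &
  odd #|[set u | inord j \in nested_list u]|].

Definition even_list v : {set 'I_k} :=
  let j := index v (enum (Q 2)) in
  if swapped v j then [set ord0; inord j] else nested_list v.

(** Colour 0 has the even support [Vs]. A colour [j >= 2] of odd support gains one vertex, the one
    of index [j] in [Q 2], whose nested list is {0, 1}; distinct colours change distinct vertices.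
    Colour 1 is then even because the list sizes have even sum. *)
Lemma lists_even (even_k : ~~ odd k) : ~~ odd #|Vs| -> (2 < k -> k <= #|Q 2|) ->
  colour_lists even_list.
Proof.
move=> even_Vs Q2k.
have QVs r v : v \in Q r -> v \in Vs by rewrite inE => /andP[].
have card_list v : v \in Vs -> #|even_list v| = degree H v %[mod k].
  move=> vVs; rewrite /even_list; case: ifP => [/and4P[]|_]; last first.
    by rewrite card_nested_list //; case: (residueP v).
  rewrite inE => /andP[_ /eqP ->] _ /andP[j2 jk] _; rewrite cards2.
  suff -> : ord0 != inord (index v (enum (Q 2))) :> 'I_k by [].
  by apply/eqP => /(congr1 val); rewrite /= inordK // => j0; rewrite -j0 in j2.
have ord0E v : v \in Vs -> ord0 \in even_list v.
  move=> vVs; rewrite /even_list; case: ifP => _; first by rewrite set21.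
  by rewrite /nested_list vVs inE.
have outE v : v \notin Vs -> even_list v = set0.
  move=> vVs; rewrite /even_list /nested_list (negPf vVs) ifN //.
  by apply: contra vVs => /andP[/QVs].
have parity2 i : 2 <= i -> ~~ odd #|[set v | i \in even_list v]|.
  move=> i2; set N0 := [set v | i \in nested_list v].
  have iN0 v : v \in Q 2 -> 2 < k -> v \notin N0.
    move=> vQ k2; have vVs := QVs _ _ vQ; move: vQ; rewrite !inE => /andP[_ /eqP dv].
    rewrite /nested_list vVs inE -ltnNge /residue -modnDml dv modnDml.
    by rewrite (_ : 2 + k.-1 = 1 + k) ?modnDr ?modn_small.
  have k2 : 2 < k by exact: leq_ltn_trans i2 (ltn_ord i).
  have memE v : (i \in even_list v) = (v \in N0) || swapped v i.
    rewrite /even_list; case: (boolP (swapped v _)) => [sw|nsw].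
      have /and4P[vQ _ /andP[j2 jk] _] := sw.
      rewrite (negPf (iN0 v vQ k2)) !inE /=.
      have -> /= : (i == ord0) = false by apply/negP => /eqP i0; rewrite i0 in i2.
      apply/eqP/idP => [iE|/and4P[_ /eqP ji _ _]]; last by rewrite ji inord_val.
      by rewrite [in X in swapped _ X]iE inordK.
    rewrite inE [swapped v i](_ : _ = false) ?orbF //.
    by apply: contraNF nsw => sw; have /and4P[_ /eqP -> _ _] := sw.
  case: (boolP (odd #|N0|)) => oN0; last first.
    rewrite (_ : [set v | i \in even_list v] = N0) //; apply/setP => v.
    rewrite inE memE [swapped v i](_ : _ = false) ?orbF //.
    by apply: contraNF oN0 => /and4P[_ _ _]; rewrite inord_val.
  have iQ : i < size (enum (Q 2)).
    by rewrite -cardE; apply: leq_trans (ltn_ord i) (Q2k k2).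
  have [v0 _] : exists v0, v0 \in Q 2.
    by apply/card_gt0P; apply: leq_trans (Q2k k2).
  set x := nth v0 (enum (Q 2)) i.
  have xQ : x \in Q 2 by rewrite -mem_enum mem_nth.
  have -> : [set v | i \in even_list v] = x |: N0.
    apply/setP => v; rewrite !inE memE orbC inE; congr (_ || _).
    apply/idP/eqP => [/and4P[vQ /eqP vi _ _]|->].
      by rewrite /x -vi nth_index ?mem_enum.
    by apply/and4P; split; rewrite ?inord_val ?i2 ?ltn_ord // index_uniq ?enum_uniq.
  by rewrite cardsU1 (iN0 _ xQ k2) add1n /= oN0.
split=> // [v vQ0|_ i i0].
  have vVs := QVs _ _ vQ0; apply/setP => i; rewrite inE /even_list ifN.
    move: vQ0; rewrite inE => /andP[_ /eqP dv]; rewrite /nested_list vVs inE.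
    have -> : residue v = k.-1 by rewrite /residue -modnDml dv mod0n add0n modn_small.
    by rewrite -ltnS ltn_ord.
  apply/negP => /and4P[]; rewrite inE => /andP[_ /eqP d2] _ /andP[j2 jk] _.
  move: vQ0; rewrite inE => /andP[_ /eqP d0].
  by move: (esym d2); rewrite d0 mod0n modn_small //; exact: leq_ltn_trans j2 jk.
have [i2|] := leqP 2 i; first exact: parity2.
rewrite ltnS leq_eqVlt ltnS leqn0 => /orP[/eqP i1|/eqP i0']; last first.
  by case/eqP: i0; apply: val_inj.
(* The supports add up to the list sizes, which agree in parity with the degrees because [k] is
   even; the degree sum is even. *)
have even_sum : ~~ odd (\sum_(j < k) #|[set v | j \in even_list v]|).
  have -> : \sum_(j < k) #|[set v | j \in even_list v]| = \sum_v #|even_list v|.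
    transitivity (\sum_(j < k) \sum_v (j \in even_list v : nat)).
      apply: eq_bigr => j _; rewrite -sum1_card big_mkcond; apply: eq_bigr => v _.
      by rewrite inE; case: (_ \in _).
    rewrite exchange_big; apply: eq_bigr => v _; rewrite -sum1_card [RHS]big_mkcond.
    by apply: eq_bigr => j _; case: (_ \in _).
  have odd_modk n p : n = p %[mod k] -> odd n = odd p.
    have k2 : 2 %| k by rewrite dvdn2.
    by move=> np; rewrite -[odd n]oddb -[odd p]oddb -!modn2 -[n %% 2](modn_dvdm _ k2) -(modn_dvdm p k2) np.
  have -> : odd (\sum_v #|even_list v|) = odd (\sum_v degree H v).
    apply: (big_ind2 (fun x y => odd x = odd y)) => // [x1 x2 y1 y2|v _].
      by rewrite !oddD => -> ->.
    case: (boolP (v \in Vs)) => vVs; first exact/odd_modk/card_list.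
    by rewrite outE // degree_out // cards0.
  by rewrite sum_degree oddM.
move: even_sum; rewrite (bigD1 ord0) //= (bigD1 i) //= !oddD.
rewrite [X in _ (+) (_ (+) X)](_ : _ = false) ?addbF; last first.
  apply: (big_ind (fun x => odd x = false)) => // [x y|j /andP[j0 ji]].
    by rewrite oddD => -> ->.
  apply/negbTE/parity2; rewrite ltnNge; apply/negP => j1.
  have : j <= 1 by []; rewrite leq_eqVlt ltnS leqn0 => /orP[/eqP jE|/eqP jE].
    by case/eqP: ji; apply: val_inj; rewrite /= jE i1.
  by case/eqP: j0; apply: val_inj.
rewrite [X in X (+) _](_ : _ = false) ?addFb //.
rewrite (_ : [set v | ord0 \in even_list v] = Vs) ?(negPf even_Vs) //.
apply/setP => v; rewrite inE; apply/idP/idP => [|/ord0E//].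
by apply: contraTT => /outE ->; rewrite inE.
Qed.

End UpperBound.

(** * Bounds for the chromatic index of an expander *)

Section Colourings.
Local Open Scope nat_scope.
Context {T : finType}.
Implicit Types (v : T) (e : edge T) (G : sgraph T).

Lemma lists_colourable k0 (H : sgraph T) (Vs : {set T}) m d h h' z K
    (S : T -> {set 'I_k0.+2}) :
  expander k0.+2 H Vs m d h h' -> Vs != set0 ->
  k0.+2.-primitive_root z -> 1 < K ->
  (forall n : nat, ~~ (k0.+2 %| n) ->
     (`|1 + z ^+ n| <= 2 - k0.+2%:R / K%:R :> algC)%R) ->
  2 * k0.+2 ^ k0.+4 * #|T|.+1 * K.-1 ^ d < K ^ d ->
  colour_lists H Vs S -> mod_colorable k0.+2 H k0.+2.
Proof.
set k := k0.+2 => expH Vs0 zk K1 gap size_bound listS.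
have sub_Vs := expander_edge expH.
have S_Vs v i : i \in S v -> v \in Vs.
  by apply: contraTT => /(lists_out listS) ->; rewrite inE.
have S_sub i : [set v | i \in S v] \subset Vs.
  by apply/subsetP => v; rewrite inE; exact: S_Vs.
have S0 e v : e \in H -> v \in val e -> ord0 \in S v.
  by move=> /sub_Vs/subsetP eV /eV; exact: (lists_ord0 listS).
(* For odd [k] the factor 2 cancels; for even [k] it is supplied by the even support of the
   colour. *)
have parity (i t : 'I_k) : i != ord0 -> k %| 2 * t -> k %| t * #|[set v | i \in S v]|.
  move=> i0 kt; case: (boolP (odd k)) => ok.
    by rewrite dvdn_mulr //; rewrite Gauss_dvdr ?coprimen2 in kt.
  have := lists_parity listS ok i0; rewrite -dvdn2 => /dvdnP[q ->].
  by rewrite mulnCA; apply: dvdn_mull; rewrite mulnC.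
have expand (i : 'I_k) (f : T -> 'I_k) : i != ord0 -> exists t : 'I_k, k %| 2 * t /\
    2 * k * d * #|[set v | (i \in S v) && (f v != t)]| <=
    #|[set e in H | (val e \subset [set v | i \in S v]) &&
       ~~ (k %| \sum_(v in val e) f v)]|.
  move=> _; have QS : residue_class k H Vs 0 \subset [set v | i \in S v].
    by apply/subsetP => v /(lists_full listS) Sv; rewrite inE Sv in_setT.
  have [t [t2 le_t]] := expander_label (isT : 1 < k) expH f Vs0 QS (S_sub i).
  exists t; split=> //; apply: leq_trans le_t; rewrite leq_mul2l subset_leq_card ?orbT //.
  by apply/subsetP => v; rewrite !inE.
have [c [/familyP cL cP]] :=
  exists_colouring S0 parity expand zk K1 gap size_bound.
have degE (i : 'I_k) v :
    degree (color_class H (fun e => c e : nat) i) v = colour_degree H c i v.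
  by apply: eq_card => e; rewrite !inE -andbA [X in _ && X]andbC.
have in_S i v : colour_degree H c i v <> 0 -> i \in S v.
  move=> /eqP; rewrite -lt0n => /card_gt0P[e]; rewrite inE => /and3P[eH ve /eqP ci].
  by have := cL e; rewrite /allowed eH !inE ci => /forallP/(_ v)/implyP; apply.
have cd1 (i : 'I_k) v : i != ord0 -> i \in S v -> colour_degree H c i v = 1 %[mod k].
  move=> i0 iS; have := cP (i, v); rewrite /active /= i0 => /(_ iS) kc.
  by apply/eqP; rewrite -(eqn_modDr k.-1) (eqP kc) add1n modnn.
exists (fun e => c e); split=> [i v|e eH]; last exact: ltn_ord.
have [ik|ki] := ltnP i k; last first.
  move=> /eqP; rewrite -lt0n => /card_gt0P[e]; rewrite !inE => /andP[/andP[_ /eqP ci] _].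
  by move: ki; rewrite -ci leqNgt ltn_ord.
rewrite (degE (Ordinal ik)); set j := Ordinal ik => dj0.
have jS := in_S _ _ dj0; have vVs := S_Vs _ _ jS.
have [j0|] := eqVneq j ord0; last by move=> j0; exact: cd1.
have degS : degree H v = \sum_(l < k) colour_degree H c l v.
  rewrite /degree -sum1_card (partition_big (fun e => c e) xpredT) //=.
  apply: eq_bigr => l _; rewrite /colour_degree -sum1_card; apply: eq_bigl => e.
  by rewrite !inE andbA.
(* Colour 0: modulo [k] each other colour contributes 1 or 0 to the degree according to the list, so
   comparison with [#|S v|] leaves 1 for colour 0. *)
have := lists_card listS vVs; rewrite degS -sum1_card big_mkcond /=.
rewrite (bigD1 ord0) //= [in RHS](bigD1 ord0) //= (lists_ord0 listS vVs) j0.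
have E : \sum_(l < k | l != ord0) colour_degree H c l v =
          \sum_(l < k | l != ord0) (if l \in S v then 1 else 0) %[mod k].
  apply: (big_ind2 (fun x y => x = y %[mod k])) => // [x1 x2 y1 y2 E1 E2|l l0].
    by rewrite -modnDm E1 E2 modnDm.
  case: ifP => lS; first exact: cd1.
  case: (eqVneq (colour_degree H c l v) 0) => [->//|/eqP/in_S].
  by rewrite lS.
by rewrite -[RHS]modnDmr E modnDmr => /eqP; rewrite eqn_modDr eq_sym => /eqP.
Qed.

(** The star at [y] takes the new colour [n]: its centre has degree 1 mod [k] and each leaf has
    degree 1. *)
Lemma star_colouring k (G : sgraph T) y n : k <= n ->
  degree G y = 1 %[mod k] ->
  mod_colorable k [set e in G | val e \subset [set~ y]] n -> mod_colorable k G n.+1.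
Proof.
set H := [set e in G | _] => kn dy [c [cP cn]].
have HE e : (e \in H) = (e \in G) && (y \notin val e).
  by rewrite inE subsets_disjoint setCK disjoint_sym disjoints1.
exists (fun e => if y \in val e then n else c e); split=> [i v|e eG]; last first.
  by case: ifP => // ye; rewrite ltnS ltnW // cn // HE eG ye.
have [-> | iN] := eqVneq i n; last first.
  have -> : color_class G (fun e => if y \in val e then n else c e) i = color_class H c i.
    apply/setP => e; rewrite [LHS]inE [RHS]inE HE.
    by case: ifP; rewrite ?[n == i]eq_sym ?(negPf iN) ?andbF ?andbT.
  exact: cP.
have -> : color_class G (fun e => if y \in val e then n else c e) n =
          [set e in G | y \in val e].
  apply/setP => e; rewrite !inE; case: (boolP (e \in G)) => //= eG.
  by case: ifP => ye; rewrite ?eqxx //; apply/negbTE; rewrite neq_ltn cn // HE eG ye.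
have [-> _|vy /eqP] := eqVneq v y.
  rewrite -dy; congr (_ %% _); apply: eq_card => e.
  by rewrite !inE -andbA andbb.
rewrite -lt0n => d0; congr (_ %% _); apply/eqP; rewrite eqn_leq d0 andbT.
apply/card_le1_eqP => e f; rewrite !inE -!andbA => /and3P[_ ye ve] /and3P[_ yf vf].
have edgeE (g : edge T) : y \in val g -> v \in val g -> val g = [set y; v].
  move=> yg vg; apply/eqP; rewrite eq_sym eqEcard (eqP (valP g)) cards2 eq_sym vy.
  by rewrite subUset !sub1set yg vg.
by apply: val_inj; rewrite (edgeE e) // (edgeE f).
Qed.

Section LowerBounds.
Variables (k m d h h' : nat) (H : sgraph T).
Hypotheses (k1 : 1 < k) (T0 : 0 < #|T|) (expH : expander k H [set: T] m d h h').
Local Notation Q := (residue_class k H [set: T]).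

Definition present n (c : edge T -> nat) v : {set 'I_n} :=
  [set i : 'I_n | degree (color_class H c i) v != 0].

Lemma card_present n c v : mod_coloring k H c -> (forall e, e \in H -> c e < n) ->
  degree H v = #|present n c v| %[mod k].
Proof.
move=> cP cn.
have -> : degree H v = \sum_(i < n) degree (color_class H c i) v.
  transitivity (\sum_(i < n) \sum_(e in H) ((v \in val e) && (c e == i))).
    rewrite exchange_big /= /degree -sum1_card big_mkcond [RHS]big_mkcond; apply: eq_bigr => e _.
    rewrite inE; case: (boolP (e \in H)) => //= eH.
    rewrite (bigD1 (Ordinal (cn e eH))) //= eqxx andbT big1 ?addn0 => [|i ie].
      by case: (v \in _).
    rewrite [c e == i](_ : _ = false) ?andbF //; apply/negP => /eqP ci.
    by case/eqP: ie; apply: val_inj.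
  apply: eq_bigr => i _; rewrite /degree -sum1_card big_mkcond [RHS]big_mkcond.
  apply: eq_bigr => e _; rewrite !inE andbAC -andbA.
  by case: (e \in H) => //=; case: (_ && _).
rewrite /present -sum1_card [in RHS]big_mkcond.
apply: (big_ind2 (fun x y => x = y %[mod k])) => // [x1 x2 y1 y2 E1 E2|i _].
  by rewrite -modnDm E1 E2 modnDm.
by rewrite inE; case: eqP => [->|/cP].
Qed.

Lemma mem_joined v r : r < k -> exists e u,
  [/\ e \in H, v \in val e, u \in val e & u \in Q r].
Proof.
move=> rk; have := expander_joined expH (in_setT v) rk.
have m0 := expander_m_gt0 k1 expH.
case: (set_0Vmem (joined H v (Q r))) => [->|[e]]; first by rewrite cards0; lia.
rewrite inE => /and3P[eH ve /existsP[u /and3P[ue _ uQ]]] _.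
by exists e, u; split.
Qed.

Lemma edge_present n c v e (eH : e \in H) (cn : c e < n) :
  v \in val e -> Ordinal cn \in present n c v.
Proof.
move=> ve; rewrite inE -lt0n; apply/card_gt0P; exists e.
by rewrite !inE eH ve /= eqxx.
Qed.

(** A vertex of [Q 0] on some edge sees a positive number of colours divisible by [k]. *)
Lemma mod_colorable_ge n : mod_colorable k H n -> k <= n.
Proof.
case=> c [cP cn]; have [w _] : exists w : T, w \in T by apply/card_gt0P.
have [e [u [eH _ ue]]] := mem_joined w (ltnW k1).
rewrite inE => /andP[_ /eqP du].
have := card_present u cP cn; rewrite du mod0n => /esym/eqP /(@dvdn_leq k) kp.
rewrite -[n]card_ord; apply: leq_trans (kp _) (max_card _).
by apply/card_gt0P; exists (Ordinal (cn e eH)); exact: edge_present.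
Qed.

(** With [k] colours a vertex of [Q 1] sees exactly one. Since [Q 1] is connected this colour is the
    same throughout, and since every vertex has a neighbour in [Q 1] it is seen everywhere. Its
    degrees are then all odd, against the handshake lemma. *)
Lemma odd_not_colorable : ~~ odd k -> odd #|T| -> ~ mod_colorable k H k.
Proof.
move=> ek oT [c [cP ck]].
have present1 v i j : v \in Q 1 -> i \in present k c v -> j \in present k c v -> i = j.
  rewrite inE => /andP[_ /eqP dv] iP jP.
  suff /card_le1_eqP le1 : #|present k c v| <= 1 by exact: le1.
  have := card_present v cP ck; rewrite dv => /esym p1.
  have := max_card (present k c v); rewrite card_ord leq_eqVlt => /orP[/eqP pk|pk].
    by move: p1; rewrite pk modnn modn_small.
  by move: p1; rewrite !modn_small // => ->.
have [w _] : exists w : T, w \in T by apply/card_gt0P.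
have [e0 [u0 [e0H _ ue0 u0Q]]] := mem_joined w k1.
pose i0 := Ordinal (ck e0 e0H).
pose A := [set v in Q 1 | i0 \in present k c v].
pose B := Q 1 :\: A.
have u0A : u0 \in A by rewrite inE u0Q edge_present.
have B0 : B = set0.
  apply/eqP/negPn/negP => B0.
  have ABQ : A :|: B = Q 1.
    apply/setP => v; rewrite in_setU in_setD; case: (boolP (v \in A)) => //= vA.
    by move: vA; rewrite inE => /andP[->].
  have dAB : [disjoint A & B] by rewrite disjoint_sym disjoints_subset subsetDr.
  have A0 : A != set0 by apply/set0Pn; exists u0.
  have [e eH /(crossP _ dAB)[x [y [xA yB exy]]]] :=
    residue_class_connected k1 expH k1 ABQ dAB A0 B0.
  have yQ : y \in Q 1 by move: yB; rewrite inE => /andP[].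
  have /andP[xQ xi0] : (x \in Q 1) && (i0 \in present k c x) by move: xA; rewrite inE.
  have pe v : v \in val e -> Ordinal (ck e eH) \in present k c v by exact: edge_present.
  have ei0 : Ordinal (ck e eH) = i0.
    by apply: (present1 x) => //; apply: pe; rewrite exy set21.
  have : y \in A by rewrite inE yQ -ei0 pe // exy set22.
  by move: yB; rewrite inE => /andP[/negPf ->].
have all_i0 v : i0 \in present k c v.
  have [e [u [eH ve ue uQ]]] := mem_joined v k1.
  have uA : i0 \in present k c u.
    apply: contraT => nu; have := in_set0 u; rewrite -B0 !inE.
    move: uQ nu; rewrite !inE /= => -> -> //.
  suff <- : Ordinal (ck e eH) = i0 by exact: edge_present.
  by apply: (present1 u) => //; exact: edge_present.
have := sum_degree (color_class H c i0).
move=> /(congr1 odd); rewrite oddM /=.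
have -> : odd (\sum_v degree (color_class H c i0) v) = odd (\sum_(v : T) 1).
  apply: (big_ind2 (fun x y => odd x = odd y)) => // [x1 x2 y1 y2|v _].
    by rewrite !oddD => -> ->.
  have := all_i0 v; rewrite inE => /eqP/cP E.
  have k2 : 2 %| k by rewrite dvdn2.
  by rewrite -[odd _]oddb -modn2 -(modn_dvdm _ k2) E modn_dvdm.
by rewrite sum1_card oT.
Qed.

End LowerBounds.
End Colourings.

(** * Random graphs *)

Section EdgeCounts.
Context {T : finType}.
Implicit Types (A B S : {set T}) (e f : edge T) (v : T).

Lemma card_cross A B : [disjoint A & B] ->
  (#|A| * #|B| <= #|[set e : edge T | cross A B e]|)%N.
Proof.
move=> dAB; rewrite -cardsX -(card_imset _ val_inj).
rewrite -(@card_in_imset _ _ (fun xy : T * T => [set xy.1; xy.2])).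
  apply/subset_leq_card/subsetP => _ /imsetP[[x y] /setXP[/= xA yB] ->].
  have xy : x != y by apply: contraTneq xA => ->; rewrite (disjointFl dAB).
  have c2 : #|[set x; y]| == 2%N by rewrite cards2 xy.
  by apply/imsetP; exists (Sub [set x; y] c2) => //; rewrite inE; apply/crossP => //; exists x, y.
have sep a b : a \in A -> b \in B -> (a == b) = false.
  by move=> aA bB; apply: contraTF aA => /eqP ->; rewrite (disjointFl dAB).
move=> [x y] [x' y'] /setXP[/= xA yB] /setXP[/= xA' yB'] /setP eqS.
have := eqS x; rewrite !inE eqxx (sep x y') // orbF => /esym/eqP ->.
have := eqS y; by rewrite !inE eqxx orbT [y == x']eq_sym (sep x' y) //= => /esym/eqP ->.
Qed.

Lemma card_inner S : (#|[set e : edge T | val e \subset S]| <= #|S| * #|S|)%N.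
Proof.
rewrite -(card_imset _ val_inj).
apply: (@leq_trans #|[set A : {set T} | (A \subset S) && (#|A| == 2%N)]|).
  apply/subset_leq_card/subsetP => _ /imsetP[e eS ->].
  by rewrite inE in eS; rewrite inE eS (valP e).
by rewrite cards_draws bin2 leq_half_double -addnn; case: #|S| => //= n; nia.
Qed.

End EdgeCounts.

(** * Union bounds and exponential tail bounds *)

Section Tails.
Context {R : realType} {E : finType} (p : R).
Hypothesis p01 : 0 <= p <= 1.
Implicit Types (P Q : pred {set E}) (A : {set E}).

Definition prob P : R := expect p (fun G => (P G)%:R).

Lemma prob_le P Q : (forall G, P G -> Q G) -> prob P <= prob Q.
Proof.
move=> PQ; apply: le_expect => // G.
by rewrite ler_nat; case: (P G) (PQ G) => // ->.
Qed.

Lemma prob_exists (I : finType) (P : I -> pred {set E}) (D : pred I) :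
  prob (fun G => [exists i, D i && P i G]) <= \sum_(i | D i) prob (P i).
Proof.
rewrite -expect_sum; apply: le_expect => // G.
case: (boolP [exists i, _]) => [/existsP[i /andP[Di Pi]]|_].
  rewrite (bigD1 i) //= Pi lerDl; exact: sumr_ge0.
by apply: sumr_ge0.
Qed.

Lemma prob_or P Q : prob (fun G => P G || Q G) <= prob P + prob Q.
Proof.
rewrite -expectD; apply: le_expect => // G.
by rewrite -natrD ler_nat; case: (P G) (Q G) => [] [].
Qed.

Lemma probC P : prob (fun G => ~~ P G) = 1 - prob P.
Proof.
rewrite -[1](@expect_cst R E p) -mulN1r -expectZl -expectD.
by apply: eq_expect => G; case: (P G); rewrite ?mulr1 ?mulr0 ?subrr ?addr0.
Qed.

Lemma prob_markov P (F : {set E} -> R) x : (forall G, 0 <= F G) ->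
  (forall G, P G -> x <= F G) -> x * prob P <= expect p F.
Proof.
move=> F0 Px; rewrite -expectZl; apply: le_expect => // G.
by case: (boolP (P G)) => [/Px|_]; rewrite ?mulr1 ?mulr0.
Qed.

Lemma expect_exp A (z : R) :
  expect p (fun G => z ^+ #|A :&: G|) = (p * z + (1 - p)) ^+ #|A|.
Proof.
transitivity (expect p (fun G => \prod_e (if e \in G then (if e \in A then z else 1) else 1))).
  apply: eq_expect => G; rewrite -prodr_const [LHS]big_mkcond.
  by apply: eq_bigr => e _; rewrite inE andbC; case: (e \in G).
rewrite expect_prod -prodr_const [RHS]big_mkcond; apply: eq_bigr => e _.
by case: ifP => _; ring.
Qed.

(** Markov's inequality for 2 to the power [#|A :&: G|], whose mean is (1 + p)^|A|; the lower tail
    below uses base 1/2 and mean (1 - p/2)^|A|. *)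
Lemma prob_upper_tail A t :
  prob (fun G => t <= #|A :&: G|)%N <= 2^-1 ^+ t * expR (p * #|A|%:R).
Proof.
rewrite exprVn ler_pdivlMl ?exprn_gt0 //.
apply: (@le_trans _ _ (expect p (fun G => 2 ^+ #|A :&: G|))).
  by apply: prob_markov => G; [exact: exprn_ge0|apply: ler_weXn2l; lra].
rewrite expect_exp [in leRHS]mulrC expRM_natl; apply: lerXn2r; rewrite ?nnegrE ?expR_ge0 //.
  by case/andP: p01; lra.
by apply: le_trans (expR_ge1Dx p); lra.
Qed.

Lemma prob_lower_tail A t :
  prob (fun G => #|A :&: G| <= t)%N <= 2 ^+ t * expR (- (p / 2 * #|A|%:R)).
Proof.
rewrite -ler_pdivrMl ?exprn_gt0 //.
apply: (@le_trans _ _ (expect p (fun G => 2^-1 ^+ #|A :&: G|))).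
  apply: prob_markov => G; first by rewrite exprn_ge0.
  by rewrite -exprVn => le_t; apply: ler_wiXn2l => //; lra.
rewrite expect_exp -mulNr [in leRHS]mulrC expRM_natl; apply: lerXn2r; rewrite ?nnegrE ?expR_ge0 //.
  by case/andP: p01; lra.
by apply: le_trans (expR_ge1Dx _); lra.
Qed.

Lemma sum_exp_card (x : R) : \sum_(S : {set E}) x ^+ #|S| = (1 + x) ^+ #|E|.
Proof.
rewrite -prodr_const addrC bigA_distr; apply: eq_bigr => S _.
by rewrite -prodr_const big_mkcond.
Qed.

End Tails.

Lemma resampleD (R : realType) (E : finType) (p : R) (s : seq E) F1 F2 (G : {set E}) :
  resample p s (fun G => F1 G + F2 G) G = resample p s F1 G + resample p s F2 G.
Proof. by elim: s G => //= e s IHs G; rewrite /resample1 !IHs; ring. Qed.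

Lemma resample_cst (R : realType) (E : finType) (p : R) (s : seq E) x (G : {set E}) :
  resample p s (fun=> x) G = x.
Proof. by elim: s G => //= e s IHs G; rewrite /resample1 !IHs; ring. Qed.

Section RandomGraph.
Context {R : realType} {T : finType} (p : R).
Hypothesis p01 : 0 <= p <= 1.
Implicit Types (G : sgraph T) (A B S U W Vs : {set T}) (v : T) (e f : edge T).

Definition induced G Vs : sgraph T := [set e in G | val e \subset Vs].

Definition sparse m h G := [forall S : {set T}, (#|S| <= h)%N ==>
  (#|[set e in G | val e \subset S]| <= m * #|S|)%N].

Definition dense h t G := [forall AB : {set T} * {set T},
  [&& [disjoint AB.1 & AB.2], (h <= #|AB.1|)%N & (h <= #|AB.2|)%N] ==>
  (t <= #|[set e in G | cross AB.1 AB.2 e]|)%N].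

Lemma setI_sep (P : pred (edge T)) G : [set e | P e] :&: G = [set e in G | P e].
Proof. by apply/setP => e; rewrite !inE andbC. Qed.

(** A set [S] of size [s <= h] spans at most [s * h] pairs, so it fails with probability at most
    [y ^+ s]. Summing over all sets gives (1 + y)^n, and the empty set accounts for the subtracted
    1. *)
Lemma prob_not_sparse m h :
  prob p (fun G => ~~ sparse m h G) <=
  (1 + 2^-1 ^+ m * expR (p * h%:R)) ^+ #|T| - 1.
Proof.
set y := _ * _; have y0 : 0 <= y by rewrite mulr_ge0 ?exprn_ge0 ?expR_ge0.
apply: (@le_trans _ _ (prob p (fun G => [exists S : {set T},
  ((S != set0) && (#|S| <= h)%N) &&
  (m * #|S| <= #|[set e : edge T | val e \subset S] :&: G|)%N]))).
  apply: prob_le => // G; rewrite negb_forall => /existsP[S].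
  rewrite negb_imply -ltnNge => /andP[Sh Sm]; apply/existsP; exists S.
  rewrite setI_sep Sh andbT (ltnW Sm) andbT; apply: contraTneq Sm => ->.
  rewrite cards0 muln0 -leqNgt leqn0; apply/eqP/eq_card0 => e; rewrite !inE.
  apply/negP => /andP[_ /subset_leq_card].
  by rewrite (eqP (valP e)) cards0.
apply: le_trans (prob_exists p01 _ _) _.
rewrite -sum_exp_card [in leRHS](bigD1 set0) //= cards0 expr0 addrAC subrr add0r.
rewrite [leRHS](bigID (fun S => #|S| <= h)%N) /= -[leLHS]addr0.
apply: lerD; last by apply: sumr_ge0 => S _; rewrite exprn_ge0.
apply: ler_sum => S /andP[_ Sh].
apply: le_trans (prob_upper_tail p01 _ _) _.
rewrite exprM exprMn; apply: ler_wpM2l; first by rewrite !exprn_ge0.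
rewrite -expRM_natl ler_expR mulrCA; case/andP: p01 => p0 _.
rewrite ler_wpM2l // -natrM ler_nat; apply: leq_trans (card_inner S) _.
by rewrite leq_mul2l Sh orbT.
Qed.

(** Union bound over the 4^n pairs of sets, with the lower tail for at least [h * h] crossing
    pairs. *)
Lemma prob_not_dense h t :
  prob p (fun G => ~~ dense h t G) <=
  4 ^+ #|T| * (2 ^+ t * expR (- (p / 2 * (h * h)%:R))).
Proof.
pose far (AB : {set T} * {set T}) :=
  [&& [disjoint AB.1 & AB.2], (h <= #|AB.1|)%N & (h <= #|AB.2|)%N].
apply: (@le_trans _ _ (prob p (fun G => [exists AB : {set T} * {set T}, far AB &&
  (#|[set e : edge T | cross AB.1 AB.2 e] :&: G| <= t)%N]))).
  apply: prob_le => // G; rewrite negb_forall => /existsP[AB].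
  rewrite negb_imply -ltnNge => /andP[farAB lt_t]; apply/existsP; exists AB.
  by apply/andP; split; [exact: farAB | rewrite setI_sep ltnW].
apply: le_trans (prob_exists p01 _ _) _.
set y := 2 ^+ t * _; have y0 : 0 <= y by rewrite mulr_ge0 ?exprn_ge0 ?expR_ge0.
apply: (@le_trans _ _ (\sum_(AB : {set T} * {set T}) y)); last first.
  have cardS : #|{set T}| = (2 ^ #|T|)%N.
    by rewrite -[#|T|]cardsT -card_powerset; apply: eq_card => S; rewrite !inE subsetT.
  by rewrite sumr_const card_prod !cardS -expnMn -[leLHS]mulr_natl natrX.
rewrite [leRHS](bigID far) /= -[leLHS]addr0; apply: lerD; last exact: sumr_ge0.
apply: ler_sum => -[A B] /and3P[/= dAB Ah Bh].
apply: le_trans (prob_lower_tail p01 _ _) _.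
rewrite ler_wpM2l ?exprn_ge0 // ler_expR lerN2 ler_wpM2l //.
  by case/andP: p01 => p0 _; rewrite divr_ge0.
by rewrite ler_nat; apply: leq_trans (leq_mul Ah Bh) (card_cross dAB).
Qed.

(** * Neighbours of prescribed degree modulo k *)

Section Neighbourhood.
Variables (k r : nat) (Vs U W : {set T}) (v : T).
Hypotheses (k0 : (0 < k)%N) (UVs : U \subset Vs) (WVs : W \subset Vs) (vVs : v \in Vs)
  (vU : v \notin U) (vW : v \notin W) (dUW : [disjoint U & W]).
Hypotheses (p01s : 0 < p < 1) (Wp : k%:R <= 2 * #|W|%:R * p)
  (Wq : k%:R <= 2 * #|W|%:R * (1 - p)).

Let star : {set edge T} := [set e | cross [set v] U e].

Let dv1 : [disjoint [set v] & U]. Proof. by rewrite disjoints1. Qed.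

Let starP e : e \in star -> exists2 u, u \in U & val e = [set v; u].
Proof.
by rewrite inE => /(crossP _ dv1)[x [u [/set1P -> uU ee]]]; exists u.
Qed.

Let hit G e := (e \in G) && [exists u in val e,
  (u != v) && (degree (induced G Vs) u == r %[mod k])].

Let delta : R := 8^-1 ^+ k.

Let delta01 : 0 <= delta <= 1.
Proof. by rewrite exprn_ge0 //= exprn_ile1 //; lra. Qed.

Let touched : {set edge T} := [set f | cross W U f].

(* Resampling only the pairs between W and the endpoint u of e in U changes the
   degree of u by a binomial variable and leaves the other degrees in U alone. *)
Let hit_resample e G : e \in star ->
  resample p (enum [set f | cross W (val e :&: U) f]) (fun G => 1 - 2^-1 * (hit G e)%:R) G
  <= 1 - delta / 2 * (e \in G)%:R.
Proof.
move=> /starP[u uU ee]; set L := enum _.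
have uv : u != v by apply: contraNneq vU => <-.
have uW : u \notin W by rewrite (disjointFr dUW).
have eU : val e :&: U = [set u].
  apply/setP => x; rewrite ee !inE; have [->|xu] := eqVneq x u; first by rewrite uU orbT.
  by rewrite orbF; case: eqP => // ->; rewrite (negPf vU).
have dWu : [disjoint W & [set u]] by rewrite disjoint_sym disjoints1.
have LP f : f \in L -> exists2 w, w \in W & val f = [set w; u].
  rewrite mem_enum inE eU => /(crossP _ dWu)[w [x [wW /set1P -> ff]]].
  by exists w.
pose D G := degree (induced G Vs) u.
have hitE H : hit H e = (e \in H) && (D H == r %[mod k]).
  rewrite /hit; congr (_ && _); apply/existsP/idP => [[x]|Dr]; last first.
    by exists u; rewrite ee set22 uv.
  rewrite ee !inE => /and3P[/orP[/eqP->|/eqP->]]; last by [].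
  by rewrite eqxx.
have eL : e \notin L.
  apply/negP => /LP[w wW ef]; have : v \in val e by rewrite ee set21.
  rewrite ef !inE => /orP[/eqP vw|/eqP vu].
    by move: vW; rewrite vw wW.
  by rewrite vu eqxx in uv.
pose phi j : R := (j == r %[mod k])%:R.
have -> : resample p L (fun H => 1 - 2^-1 * (hit H e)%:R) G =
    1 - 2^-1 * (e \in G)%:R * resample p L (fun H => phi (D H)) G.
  have -> : (fun H : {set edge T} => 1 - 2^-1 * (hit H e)%:R) =
      (fun H : {set edge T} => 1 * 1 + (- (2^-1 * (e \in H)%:R)) * phi (D H)).
    by apply/funext => H; rewrite hitE mulr1 mulNr -mulrA -natrM mulnb.
  rewrite resampleD resampleM // resample_cst resampleM ?mulr1 ?mulNr //.
  move=> f H fL; have ef : e != f by apply: contraNneq eL => ->.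
  by rewrite !inE ef (negPf ef).
have -> : delta / 2 * (e \in G)%:R = 2^-1 * (e \in G)%:R * delta by ring.
rewrite lerD2l lerN2 ler_wpM2l ?mulr_ge0 //.
have sizeL : (#|W| <= size L)%N.
  by rewrite -cardE eU; have := card_cross dWu; rewrite cards1 muln1.
have DL f H : f \in L -> D (f |: H) = (D (H :\ f)).+1.
  move=> /LP[w wW ff]; have fVs : val f \subset Vs.
    by rewrite ff subUset !sub1set (subsetP WVs) // (subsetP UVs).
  have uf : u \in val f by rewrite ff set22.
  have -> : D (f |: H) = #|f |: [set g in induced (H :\ f) Vs | u \in val g]|.
    apply: eq_card => g; rewrite !inE; have [->|gf] := eqVneq g f; last by [].
    by rewrite fVs uf.
  by rewrite cardsU1 !inE eqxx.
rewrite (resample_binom p phi G (enum_uniq _) DL).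
have /andP[p0 p1] := p01s.
have leL : #|W|%:R <= (size L)%:R :> R by rewrite ler_nat.
apply: binom_expect_residue => //.
  by apply: le_trans Wp _; rewrite ler_wpM2r ?(ltW p0) // ler_wpM2l.
by apply: le_trans Wq _; rewrite ler_wpM2r ?subr_ge0 ?(ltW p1) // ler_wpM2l.
Qed.

(** Markov's inequality for 1/2 to the power of the number of hits. The factors are replaced one at
    a time by ones that depend only on the presence of the edge, and these are independent. *)
Lemma prob_few_joined c :
  prob p (fun G => #|joined (induced G Vs) v (residue_class k (induced G Vs) Vs r)| <= c)%N
  <= 2 ^+ c * (1 - p * (8^-1 ^+ k / 2)) ^+ #|U|.
Proof.
rewrite -ler_pdivrMl ?exprn_gt0 //.
have half01 G e : 0 <= 1 - 2^-1 * (hit G e)%:R :> R by case: (hit G e) => /=; rewrite ?mulr1 ?mulr0; lra.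
apply: (@le_trans _ _ (expect p (fun G => \prod_(e <- enum star) (1 - 2^-1 * (hit G e)%:R)))).
  apply: prob_markov => // [G|G le_c]; first exact: prodr_ge0.
  have -> : \prod_(e <- enum star) (1 - 2^-1 * (hit G e)%:R) =
      2^-1 ^+ #|[set e in star | hit G e]| :> R.
    rewrite big_enum -prodr_const /= big_mkcond [RHS]big_mkcond; apply: eq_bigr => e _.
    by rewrite [in RHS]inE; case: (e \in star) => //; case: (hit G e) => /=; rewrite ?mulr1 ?mulr0; lra.
  rewrite -exprVn; apply: ler_wiXn2l; [lra|lra|].
  apply: leq_trans le_c; apply/subset_leq_card/subsetP => e.
  rewrite inE => /andP[/starP[u uU ee] /andP[eG /existsP[x /and3P[xe xv dx]]]].
  have xu : x = u by move: xe; rewrite ee !inE (negPf xv) => /eqP.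
  have uVs := subsetP UVs u uU.
  rewrite !inE eG ee subUset !sub1set vVs uVs set21 /=.
  move: xv dx; rewrite xu => uv du; apply/existsP; exists u.
  by rewrite set22 uv inE uVs du.
(* A pair between [W] and [U] affects only the hit at its own end in [U]. *)
have hit_indep (e f : edge T) G : e \in star -> f \in touched -> [disjoint val e & val f :&: U] ->
    hit (f |: G) e = hit G e /\ hit (G :\ f) e = hit G e.
  move=> eS fT ef; have [u uU ee] := starP eS.
  have eN : e != f.
    apply: contraTneq ef => <-; apply/pred0Pn; exists u.
    by rewrite /= inE ee set22 uU.
  have uf : u \notin val f.
    by apply: contraTN ef => uf; apply/pred0Pn; exists u; rewrite /= inE ee set22 uU uf.
  have deg_eq G1 G2 : (forall g, g != f -> (g \in G1) = (g \in G2)) ->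
      hit G1 e = hit G2 e.
    move=> G12; rewrite /hit (G12 e eN); congr (_ && _).
    apply: eq_existsb => x; case: (boolP (x \in val e)) => //= xe.
    have [->|xv] := eqVneq x v; first by [].
    have -> : x = u by move: xe; rewrite ee !inE (negPf xv) => /eqP.
    congr (_ == _ %[mod k]); apply: eq_card => g; rewrite [LHS]inE [RHS]inE.
    have [->|gf] := eqVneq g f; first by rewrite (negPf uf) !andbF.
    by rewrite !inE G12.
  by split; apply: deg_eq => g gf; rewrite !inE (negPf gf).
(* [X] collects the factors already replaced; it ignores all pairs between [W] and [U], so later
   resampling leaves it fixed. *)
have mono X (s : seq (edge T)) : uniq s -> {subset s <= star} -> (forall G, 0 <= X G) ->
    (forall f G, f \in touched -> X (f |: G) = X G /\ X (G :\ f) = X G) ->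
    expect p (fun G => X G * \prod_(e <- s) (1 - 2^-1 * (hit G e)%:R)) <=
    expect p (fun G => X G * \prod_(e <- s) (1 - delta / 2 * (e \in G)%:R)).
  elim: s X => [|e s IHs] X; first by move=> *; apply: le_expect => // G; rewrite !big_nil.
  case/andP=> es us sS X0 XT; have eS : e \in star by rewrite sS ?mem_head.
  have sS' : {subset s <= star} by move=> f fs; rewrite sS // inE fs orbT.
  have [u uU ee] := starP eS.
  have h01 G : 0 <= 1 - delta / 2 * (e \in G)%:R.
    by case/andP: delta01 => d0 d1; case: (e \in G); rewrite ?mulr1 ?mulr0; lra.
  pose X' G := X G * (1 - delta / 2 * (e \in G)%:R).
  apply: (@le_trans _ _ (expect p (fun G => X' G * \prod_(e <- s) (1 - 2^-1 * (hit G e)%:R)))).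
    pose Z G := X G * \prod_(e <- s) (1 - 2^-1 * (hit G e)%:R).
    pose L := enum [set f | cross W (val e :&: U) f].
    rewrite (@eq_expect _ _ _ _ (fun G => Z G * (1 - 2^-1 * (hit G e)%:R))) => [|G]; last first.
      by rewrite big_cons /Z mulrA mulrAC.
    rewrite (@eq_expect _ _ _ (fun G => X' G * _) (fun G => Z G * (1 - delta / 2 * (e \in G)%:R))) => [|G]; last first.
      by rewrite /X' /Z mulrAC.
    rewrite -(expect_resample p L); apply: le_expect => // G.
    rewrite resampleM => [|f H].
      rewrite ler_wpM2l ?hit_resample // mulr_ge0 ?prodr_ge0 //.
    rewrite mem_enum inE => fe.
    have eU : val e :&: U = [set u].
      apply/setP => x; rewrite ee !inE; have [->|xu] := eqVneq x u; first by rewrite uU orbT.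
      by rewrite orbF; case: eqP => // ->; rewrite (negPf vU).
    have dWu : [disjoint W & [set u]] by rewrite disjoint_sym disjoints1 (disjointFr dUW).
    rewrite eU in fe; have [w [u' [wW /set1P -> ff]]] := crossP _ dWu fe.
    have fT : f \in touched by rewrite inE; apply/crossP; rewrite 1?disjoint_sym //; exists w, u.
    have [XT1 XT2] := XT f H fT.
    have hitE g : g \in s -> hit (f |: H) g = hit H g /\ hit (H :\ f) g = hit H g.
      move=> gs; apply: hit_indep => //; first exact: sS'.
      have [x xU gx] := starP (sS' g gs).
      apply/pred0P => y; rewrite /= gx ff !inE; apply/negP => /andP[yg /andP[yf yU]].
      have yu : y = u.
        case/orP: yf => /eqP // yw; move: yU; rewrite yw.
        by rewrite (disjointFl dUW).
      case/orP: yg => /eqP yx; first by move: vU; rewrite -yx yu uU.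
      case/negP: es; suff -> : e = g by [].
      by apply: val_inj; rewrite ee gx -yx yu.
    rewrite /Z XT1 XT2; split; congr (_ * _); apply: eq_big_seq => g gs;
      by have [H1 H2] := hitE g gs; rewrite ?H1 ?H2.
  apply: le_trans (IHs X' us sS' _ _) _.
  - by move=> G; rewrite mulr_ge0.
  - move=> f G fT; have ef : e != f.
      apply: contraTneq (set21 v u) => ef; rewrite -ee ef.
      move: fT; rewrite inE => /crossP; rewrite disjoint_sym => /(_ dUW)[w [u' [wW uU' ->]]].
      rewrite !inE negb_or; apply/andP; split.
        by apply: contraNneq vW => ->.
      by apply: contraNneq vU => ->.
    by have [H1 H2] := XT f G fT; rewrite /X' H1 H2 !inE ef (negPf ef).
  - by apply: le_expect => // G; rewrite big_cons mulrA.
have := mono (fun=> 1) (enum star) (enum_uniq _) _ (fun=> ler01) (fun _ _ _ => conj erefl erefl).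
under eq_expect do rewrite mul1r.
move=> /(_ _)/le_trans; apply; first by move=> e; rewrite mem_enum.
have -> : expect p (fun G => 1 * \prod_(e <- enum star) (1 - delta / 2 * (e \in G)%:R)) =
    (1 - p * (delta / 2)) ^+ #|star|.
  transitivity (expect p (fun G => \prod_(e : edge T)
      (if e \in G then (if e \in star then 1 - delta / 2 else 1) else 1))).
    apply: eq_expect => G; rewrite mul1r big_enum big_mkcond /=; apply: eq_bigr => e _.
    by case: (e \in G); case: (e \in star); rewrite ?mulr1 ?mulr0 ?subr0.
  rewrite expect_prod -prodr_const [RHS]big_mkcond; apply: eq_bigr => e _.
  by case: ifP => _; ring.
have /andP[p0 p1] := p01; have /andP[d0 d1] := delta01.
apply: ler_wiXn2l; [nra|nra|].
by have := card_cross dv1; rewrite cards1 mul1n.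
Qed.

End Neighbourhood.
End RandomGraph.

Section GoodGraphs.
Context {T : finType}.
Implicit Types (G : sgraph T) (v : T) (Vs : {set T}).

Definition rich k m G Vs := [forall v in Vs, forall r : 'I_k,
  (4 * m <= #|joined (induced G Vs) v (residue_class k (induced G Vs) Vs r)|)%N].

(** The deleted vertex is the centre of the extra star. It is chosen after the graph is known, so
    [good] asks for richness for every choice. *)
Definition omit (o : option T) : {set T} := if o is Some y then [set~ y] else [set: T].

Definition good k m d h h' G := [&& [forall o, rich k m G (omit o)], sparse m h G
  & dense h' (2 * k * d * #|T|) G].

Lemma good_expander k m d h h' G o : good k m d h h' G ->
  [/\ 0 < d, k * d <= m, k <= h & 2 * k * h' <= h]%N ->
  expander k (induced G (omit o)) (omit o) m d h h'.
Proof.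
case/and3P => /forallP/(_ o) richG sparseG denseG params; split=> //.
- by move=> e; rewrite inE => /andP[].
- move=> v r vVs rk.
  by have /forallP/(_ v)/implyP/(_ vVs)/forallP/(_ (Ordinal rk)) := richG.
- move=> S _ Sh; have /forallP/(_ S)/implyP/(_ Sh) := sparseG.
  apply: leq_trans; apply/subset_leq_card/subsetP => e.
  by rewrite !inE => /andP[/andP[-> _] ->].
move=> A B AVs BVs dAB Ah Bh.
have /forallP/(_ (A, B))/implyP := denseG; rewrite /= dAB Ah Bh => /(_ isT).
move/leq_trans; apply; apply/subset_leq_card/subsetP => e.
rewrite !inE => /andP[-> eAB]; rewrite eAB andbT /=.
have [x [y [xA yB ->]]] := crossP _ dAB eAB.
by rewrite subUset !sub1set (subsetP AVs) // (subsetP BVs).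
Qed.

Lemma induced_setT G : induced G [set: T] = G.
Proof. by apply/setP => e; rewrite inE subsetT andbT. Qed.

Lemma mod_chromatic_indexP k G n : mod_colorable k G n ->
  (forall m, mod_colorable k G m -> (n <= m)%N) -> mod_chromatic_index k G = n.
Proof.
move=> Gn min_n; rewrite /mod_chromatic_index; case: ex_minnP => m /asboolP Gm min_m.
apply/eqP; rewrite eqn_leq min_n // andbT; apply: min_m; exact/asboolP.
Qed.

Lemma expander_colourable k H Vs m d h h' z K : (1 < k)%N ->
  expander k H Vs m d h h' -> Vs != set0 ->
  k.-primitive_root z -> (1 < K)%N ->
  (forall n : nat, ~~ (k %| n)%N -> `|1 + z ^+ n| <= 2 - k%:R / K%:R :> algC) ->
  (2 * k ^ k.+2 * #|T|.+1 * K.-1 ^ d < K ^ d)%N ->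
  odd k || ~~ odd #|Vs| -> mod_colorable k H k.
Proof.
case: k => [|[|k]] // k1 expH Vs0 zk K1 gap size_bound.
have sub_Vs := expander_edge expH.
case: (boolP (odd k.+2)) => [ok _|ek /= eVs].
  exact: (lists_colourable expH Vs0 zk K1 gap size_bound (nested_lists_odd H Vs ok)).
apply: (lists_colourable expH Vs0 zk K1 gap size_bound (lists_even sub_Vs ek eVs _)).
move=> k2; have [_ _ kh _] := expander_params expH.
exact: leq_trans kh (ltnW (residue_class_large k1 expH Vs0 k2)).
Qed.

Lemma good_chromatic_index k m d h h' z K G : (1 < k)%N -> (1 < #|T|)%N ->
  good k m d h h' G -> [/\ 0 < d, k * d <= m, k <= h & 2 * k * h' <= h]%N ->
  k.-primitive_root z -> (1 < K)%N ->
  (forall n : nat, ~~ (k %| n)%N -> `|1 + z ^+ n| <= 2 - k%:R / K%:R :> algC) ->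
  (2 * k ^ k.+2 * #|T|.+1 * K.-1 ^ d < K ^ d)%N ->
  mod_chromatic_index k G = if ~~ odd k && odd #|T| then k.+1 else k.
Proof.
move=> k1 T1 goodG params zk K1 gap size_bound.
have T0 := ltnW T1.
have expG := good_expander None goodG params.
rewrite /= induced_setT in expG.
case: ifP => [/andP[ek oT]|par]; apply: mod_chromatic_indexP.
(* The star at such a [y] takes the extra colour, and the remaining vertices are even in number. *)
- have [y yQ] : exists y, y \in residue_class k G [set: T] 1.
    have [w _] : exists w : T, w \in T by apply/card_gt0P.
    by have [e [u [_ _ _ uQ]]] := mem_joined k1 T0 expG w k1; exists u.
  have expy := good_expander (Some y) goodG params.
  have cardy : #|[set~ y]| = #|T|.-1 by rewrite cardsC1.
  apply: (@star_colouring _ k G y) => //.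
    by move: yQ; rewrite inE => /andP[_ /eqP].
  apply: (expander_colourable k1 expy _ zk K1 gap size_bound).
    by rewrite -card_gt0 cardy; lia.
  by rewrite cardy; apply/orP; right; case: #|T| T0 oT => //= n _; rewrite negbK.
- move=> n Gn; rewrite ltn_neqAle (mod_colorable_ge k1 T0 expG Gn) andbT.
  apply/eqP => kn; rewrite -kn in Gn.
  exact: (odd_not_colorable k1 T0 expG ek oT).
- apply: (expander_colourable k1 expG _ zk K1 gap size_bound).
    by rewrite -card_gt0 cardsT.
  by rewrite cardsT; move: par; case: (odd k) => //= ->.
- exact: (mod_colorable_ge k1 T0 expG).
Qed.

(** Union bound over the omitted vertex or none, the vertex [v] and the residue. At least n - 2
    other vertices remain, and half of them serve as [U], the rest as [W]. *)
Lemma prob_not_rich (R : realType) (p : R) k m : (0 < k)%N ->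
  0 < p < 1 -> k%:R <= 2 * ((#|T| - 2)./2)%:R * p ->
  k%:R <= 2 * ((#|T| - 2)./2)%:R * (1 - p) ->
  prob p (fun G => ~~ [forall o, rich k m G (omit o)]) <=
  (#|T|.+1 * (#|T| * k))%:R *
    (2 ^+ (4 * m) * (1 - p * (8^-1 ^+ k / 2)) ^+ ((#|T| - 2)./2)).
Proof.
move=> k0 p01s; set u := (_./2) => up uq.
have p01 : 0 <= p <= 1 by case/andP: p01s => ? ?; rewrite !ltW.
set y := _ * _ ^+ u.
have y0 : 0 <= y.
  have /andP[p0 p1] := p01; have d0 : 0 <= 8^-1 ^+ k :> R by rewrite exprn_ge0.
  have d1 : 8^-1 ^+ k <= 1 :> R by rewrite exprn_ile1 //; lra.
  by rewrite mulr_ge0 ?exprn_ge0 //; nra.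
pose few (i : option T * (T * 'I_k)) G :=
  (#|joined (induced G (omit i.1)) i.2.1
     (residue_class k (induced G (omit i.1)) (omit i.1) i.2.2)| <= 4 * m)%N.
apply: (@le_trans _ _ (prob p (fun G => [exists i, (i.2.1 \in omit i.1) && few i G]))).
  apply: prob_le => // G; rewrite negb_forall => /existsP [q].
  rewrite negb_forall => /existsP[v]; rewrite negb_imply => /andP[vq].
  rewrite negb_forall => /existsP[r]; rewrite -ltnNge => fewG.
  by apply/existsP; exists (q, (v, r)); rewrite /few /= vq ltnW.
apply: le_trans (prob_exists p01 _ _) _.
apply: (@le_trans _ _ (\sum_(i : option T * (T * 'I_k)) y)); last first.
  by rewrite sumr_const !card_prod card_option card_ord -[leLHS]mulr_natl.
rewrite [leRHS](bigID (fun i => i.2.1 \in omit i.1)) /= -[leLHS]addr0.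
apply: lerD; last exact: sumr_ge0.
apply: ler_sum => -[w [v r]] /= vw.
pose X := omit w :\ v; pose U : {set T} := [set x in take u (enum X)].
have cX : (#|T| - 2 <= #|X|)%N.
  have := cardsD1 v (omit w); rewrite vw -/X => cE.
  have : (#|T|.-1 <= #|omit w|)%N by case: (w) => [x|] /=; rewrite ?cardsC1 ?cardsT ?leq_pred.
  by lia.
have uX : (u + u <= #|X|)%N.
  by apply: leq_trans cX; rewrite addnn -[leqRHS]odd_double_half leq_addl.
have UX : U \subset X.
  by apply/subsetP => x; rewrite inE => /mem_take; rewrite mem_enum.
have cU : #|U| = u.
  rewrite cardsE; have /card_uniqP -> : uniq (take u (enum X)).
    by rewrite take_uniq ?enum_uniq.
  by rewrite size_takel // -cardE; lia.
have cW : (u <= #|X :\: U|)%N by rewrite cardsDS // cU; lia.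
have XV : X \subset omit w by rewrite subsetDl.
have vX : v \notin X by rewrite !inE eqxx.
rewrite /y -[in leRHS]cU; apply: (@prob_few_joined _ _ _ p01 k r (omit w) U (X :\: U) v) => //.
- exact: subset_trans UX XV.
- exact: subset_trans (subsetDl _ _) XV.
- by apply: contra vX; apply/subsetP.
- by apply: contra vX; apply/subsetP/subsetDl.
- by rewrite disjoint_sym disjoints_subset subsetDr.
- by apply: le_trans up _; rewrite ler_wpM2r ?ler_wpM2l ?ler_nat //; case/andP: p01.
- by apply: le_trans uq _; rewrite ler_wpM2r ?ler_wpM2l ?ler_nat // subr_ge0; case/andP: p01.
Qed.

End GoodGraphs.

(** * Choice of the parameters *)

Section Estimates.
Context {R : realType}.
Implicit Types (x p D L : R) (n m t u h d : nat).

Lemma exp2_le_expR t : 2 ^+ t <= expR t%:R :> R.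
Proof.
rewrite -[t%:R]mulr1 expRM_natl lerXn2r ?nnegrE ?expR_ge0 //.
by apply: le_trans (expR_ge1Dx 1); lra.
Qed.

Lemma exp_half_le_expR t : 2^-1 ^+ t <= expR (- (t%:R / 2)) :> R.
Proof.
rewrite -mulrN expRM_natl lerXn2r ?nnegrE ?expR_ge0 //.
by apply: le_trans (expR_ge1Dx _); lra.
Qed.

Lemma exp1B_le_expR x t : x <= 1 -> (1 - x) ^+ t <= expR (- (t%:R * x)).
Proof.
move=> x1; rewrite -mulrN expRM_natl lerXn2r ?nnegrE ?expR_ge0 ?subr_ge0 //.
exact: expR_ge1Dx.
Qed.

Lemma expRN_ln (a n : nat) : (0 < n)%N -> expR (- (a%:R * ln n%:R)) = n%:R ^- a :> R.
Proof. by move=> n0; rewrite expRN expRM_natl lnK // posrE ltr0n. Qed.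

Lemma few_joined_estimate (delta D p : R) n m u :
  0 <= delta <= 1 -> 0 <= p <= 1 -> D = n%:R * p ->
  n%:R <= 4 * u%:R :> R -> m%:R <= delta * D / 64 ->
  2 ^+ (4 * m) * (1 - p * (delta / 2)) ^+ u <= expR (- (delta * D / 16)).
Proof.
move=> /andP[d0 d1] /andP[p0 p1] DE nu mD.
have pd1 : p * (delta / 2) <= 1 by nra.
apply: (@le_trans _ _ (expR (4 * m)%:R * expR (- (u%:R * (p * (delta / 2)))))).
  apply: ler_pM; rewrite ?exprn_ge0 ?subr_ge0 ?exp2_le_expR //.
  exact: exp1B_le_expR.
rewrite -expRD ler_expR natrM.
(* The exponents are at most [delta * D / 16] from [4 * m], against at least [delta * D / 8] from
   the power [u]. *)
have : n%:R * (p * delta) <= 4 * u%:R * (p * delta) by rewrite ler_wpM2r ?mulr_ge0.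
by rewrite DE in mD *; nra.
Qed.

(** The exponent of [y] is at most -m/2 + m/4, so [y] is at most n^-2, and (1 + y)^n - 1 is at most
    2ny. *)
Lemma sparse_estimate p n m h : (1 < n)%N -> p * h%:R <= m%:R / 4 ->
  8 * ln (n%:R : R) <= m%:R ->
  (1 + 2^-1 ^+ m * expR (p * h%:R)) ^+ n - 1 <= 2 / n%:R.
Proof.
move=> n1 ph Lm; set y := _ * expR _.
have n0 : 0 < n%:R :> R by rewrite ltr0n ltnW.
have y0 : 0 <= y by rewrite mulr_ge0 ?exprn_ge0 ?expR_ge0.
have yn : n%:R * y <= n%:R^-1.
  rewrite -ler_pdivlMl // -invfM -expr2 -expRN_ln ?(ltnW n1) //.
  apply: (@le_trans _ _ (expR (- (m%:R / 2)) * expR (p * h%:R))).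
    by rewrite ler_wpM2r ?expR_ge0 ?exp_half_le_expR.
  by rewrite -expRD ler_expR; lra.
have n2 : n%:R^-1 <= 2^-1 :> R by rewrite lef_pV2 ?posrE // ler_nat.
have := exprD1_mulB_le1 n y0; have := exprD1_le2 y0 (le_trans yn n2).
have : 0 <= n%:R * y by rewrite mulr_ge0 // ltW.
move: (_ ^+ n) (n%:R * y) yn => z w wn w0 z2 zw.
have : z * w <= 2 * w by rewrite ler_wpM2r.
by lra.
Qed.

Lemma dense_estimate p n t h : (0 < n)%N ->
  3 * n%:R + t%:R <= p * (h * h)%:R / 2 ->
  4 ^+ n * (2 ^+ t * expR (- (p / 2 * (h * h)%:R))) <= n%:R^-1.
Proof.
move=> n0 le_h; have -> : 4 ^+ n = 2 ^+ (2 * n) :> R by rewrite exprM; congr (_ ^+ _); lra.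
apply: (@le_trans _ _ (expR (2 * n)%:R * (expR t%:R * expR (- (p / 2 * (h * h)%:R))))).
  by rewrite ler_pM ?mulr_ge0 ?exprn_ge0 ?expR_ge0 ?exp2_le_expR // ler_wpM2r ?expR_ge0 ?exp2_le_expR.
rewrite -!expRD; apply: (@le_trans _ _ (expR (- n%:R))).
  by rewrite ler_expR natrM; lra.
rewrite expRN lef_pV2 ?posrE ?expR_gt0 ?ltr0n //.
by apply: le_trans (expR_ge1Dx _); lra.
Qed.

(** (1 - 1/K)^d is at most exp(-d/K), hence at most n^-3, which beats the factor of order n. *)
Lemma size_estimate (n k K d : nat) : (1 < n)%N -> (1 < K)%N ->
  (4 * k ^ k.+2 < n)%N -> 3 * K%:R * ln (n%:R : R) <= d%:R ->
  (2 * k ^ k.+2 * n.+1 * K.-1 ^ d < K ^ d)%N.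
Proof.
move=> n1 K1 kn Ld; have n0 : 0 < n%:R :> R by rewrite ltr0n ltnW.
have K0 : 0 < K%:R :> R by rewrite ltr0n ltnW.
have Kd : K.-1%:R ^+ d <= n%:R ^- 3 * K%:R ^+ d :> R.
  have -> : K.-1%:R = (1 - K%:R^-1) * K%:R :> R.
    by rewrite mulrBl mul1r mulVf ?gt_eqF // -subn1 natrB // ltnW.
  rewrite exprMn ler_wpM2r ?exprn_ge0 ?(ltW K0) //.
  rewrite -expRN_ln ?(ltnW n1) //; apply: le_trans (exp1B_le_expR _ _) _.
    by rewrite invf_le1 // ler1n ltnW.
  by rewrite ler_expR lerN2 ler_pdivlMr // mulrAC.
rewrite -(ltr_nat R) natrM !natrX.
apply: (@le_lt_trans _ _ ((2 * k ^ k.+2 * n.+1)%:R * (n%:R ^- 3 * K%:R ^+ d))).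
  by rewrite ler_wpM2l.
rewrite mulrA gtr_pMl ?exprn_gt0 // ltr_pdivrMr ?exprn_gt0 // mul1r -natrX ltr_nat.
move: (k ^ k.+2)%N kn => q qn; have -> : (n ^ 3 = n * n * n)%N by rewrite !expnS expn0; lia.
by nia.
Qed.

Lemma truncn_half x : 1 <= x -> exists2 m : nat, m%:R <= x & x / 2 <= m%:R.
Proof.
move=> x1; have lt_x := truncnS_gt x; rewrite -natr1 in lt_x.
exists (Num.truncn x); first by rewrite truncn_le; lra.
have : 1 <= (Num.truncn x)%:R :> R by rewrite ler1n truncn_gt0.
by lra.
Qed.

End Estimates.

(** With D = np, the choices are [m] near [delta * D / 64], [h] near m/(4p), [d] near [c4 * D] and
    [h' = h %/ (2 * k)]. The failure probabilities 1/n, 2/n and 1/n of the three properties add up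
    to 4/n. *)
Lemma whp_chromatic_index (R : realType) (k : nat) : (1 < k)%N ->
  exists (C B : R) (N : nat), 0 < C /\ forall (T : finType) (p : R),
    (N <= #|T|)%N -> 0 <= p <= 1 -> C * ln (#|T|%:R : R) <= #|T|%:R * p ->
    B <= #|T|%:R * (1 - p) ->
    1 - 4 / #|T|%:R <= prob p (fun G : sgraph T =>
      mod_chromatic_index k G == if ~~ odd k && odd #|T| then k.+1 else k).
Proof.
move=> k1; have [z [K [zk K1 gap]]] := unity_root_gap (ltnW k1).
have [delta deltaE] : exists delta : R, delta = 8^-1 ^+ k by exists (8^-1 ^+ k).
have d0 : 0 < delta by rewrite deltaE exprn_gt0.
have d1 : delta <= 1 by rewrite deltaE exprn_ile1 //; lra.
have k2 : 2 <= k%:R :> R by rewrite ler_nat.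
have quotient (a b : R) : 0 < a -> 0 < b -> exists2 c, 0 < c & c * b = a.
  by move=> a0 b0; exists (a / b); rewrite ?divr_gt0 // divfK // gt_eqF.
(* [c] is the density guaranteed for [h'], that is [c * n <= h']; [c4] makes [k * d] at most
   [c ^+ 2 * D / 16], small against the crossing pairs expected between sets of size [h']. *)
have [|c c0 ck] := quotient delta (4096 * k%:R) d0; first by lra.
have [||c4 c40 c4k] := quotient (c ^+ 2) (16 * k%:R); [by rewrite exprn_gt0|lra|].
have KR1 : 1 <= K%:R :> R by rewrite ler1n ltnW.
have bounded (a x : R) : 0 < a -> exists2 C, 0 <= C & forall C', C <= C' -> x <= a * C'.
  move=> a0; exists (`|x| / a); first by rewrite divr_ge0 // ltW.
  by move=> C'; rewrite ler_pdivrMr // mulrC; apply: le_trans; exact: ler_norm.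
have [C1 C10 HC1] := bounded _ 1024 d0.
have [C2 C20 HC2] := bounded _ 8 (exprn_gt0 2 c0).
have [C3 C30 HC3] := bounded _ (6 * K%:R) c40.
(* In order, these bounds on [C] serve [m] (richness and sparsity), density, the size of [d] for the
   character sum, and the mean needed for binomial residues. *)
have [C [C0 CC1 CC2 CC3 CC4]] : exists C, [/\ 0 < C, 1024 <= delta * C, 8 <= c ^+ 2 * C,
    6 * K%:R <= c4 * C & 2 * k%:R <= C].
  exists (C1 + C2 + C3 + 2 * k%:R).
  by split; [|apply: HC1|apply: HC2|apply: HC3|]; clear -C10 C20 C30 k2; lra.
have [N [N1 N2 N3 N4 N5]] : exists N : nat, [/\ Num.truncn (expR 1 : R) < N,
    Num.truncn (4096 * k%:R / delta : R) < N, 2 * k <= N, 4 * k ^ k.+2 < N & 8 <= N]%N.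
  move: (Num.truncn _) (Num.truncn _) (4 * k ^ k.+2)%N => u1 u2 u3.
  by exists (u1 + u2 + u3 + 2 * k + 9)%N; clear; split; lia.
exists C, (2 * k%:R), N; split=> // T p; set n := #|T| => Nn p01 Cp Bq.
have n8 := leq_trans N5 Nn; have nk := leq_trans N3 Nn; have nkk := leq_trans N4 Nn.
have n0 : 0 < n%:R :> R by rewrite ltr0n (leq_trans _ n8).
have trunc_lt (x : R) : (Num.truncn x < n)%N -> x <= n%:R.
  move=> xn; apply: ltW; apply: lt_le_trans (truncnS_gt x) _.
  by rewrite ler_nat.
have L1 : 1 <= ln (n%:R : R).
  rewrite -[leLHS]expRK ler_ln ?posrE ?expR_gt0 //.
  by apply: trunc_lt; exact: leq_trans Nn.
have dn : 4096 * k%:R <= delta * n%:R.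
  rewrite [leRHS]mulrC -ler_pdivrMr //; apply: trunc_lt.
  exact: leq_trans Nn.
move: L1 Cp; set L := ln _; set D := n%:R * p => L1 Cp.
have big a x : 0 < a -> x <= a * C -> x * L <= a * D.
  move=> a0 xa; apply: (@le_trans _ _ (a * (C * L))); last by rewrite ler_pM2l.
  by rewrite mulrA ler_wpM2r // (le_trans ler01).
have D1 : 1024 * L <= delta * D by exact: big.
have D2 : 8 * L <= c ^+ 2 * D by apply: big; rewrite ?exprn_gt0.
have D3 : 6 * K%:R * L <= c4 * D by exact: big.
have D4 : 2 * k%:R * L <= D by rewrite -[D]mul1r; apply: big; rewrite ?mul1r.
have kD : 2 * k%:R <= D by clear -D4 k2 L1; nra.
have D0 : 0 < D by clear -kD k2; lra.
have p0 : 0 < p by rewrite -(pmulr_rgt0 _ n0).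
have [|m m1 m2] := @truncn_half R (delta * D / 64); first by clear -D1 L1; lra.
have hx : delta * n%:R / 512 <= m%:R / 4 / p.
  by rewrite ler_pdivlMr //; move: m2; rewrite /D; clear; lra.
have [|h h1 h2] := @truncn_half R (m%:R / 4 / p).
  by apply: le_trans hx; clear -dn k2; lra.
have ph : p * h%:R <= m%:R / 4 by rewrite mulrC -ler_pdivlMr.
have {hx} h3 : delta * n%:R / 1024 <= h%:R by clear -hx h2; lra.
have [|d dl dr] := @truncn_half R (c4 * D).
  by clear -D3 L1 KR1; nra.
pose h' := (h %/ (2 * k))%N.
have kh : 4 * k%:R <= h%:R :> R by clear -h3 dn; lra.
have h'l : c * n%:R <= h'%:R.
  have : (h < h'.+1 * (2 * k))%N by apply: ltn_ceil; rewrite muln_gt0 /= ltnW.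
  rewrite -(ltr_nat R) natrM natrM -natr1 => hh'.
  have k0 : 0 < 4096 * k%:R :> R by clear -k2; lra.
  rewrite -(ler_pM2r k0) mulrAC ck; clear -hh' h3 dn kh k2; lra.
have params : [/\ 0 < d, k * d <= m, k <= h & 2 * k * h' <= h]%N.
  split.
  - by rewrite -(ltr_nat R); clear -dr D3 L1 KR1; nra.
  - rewrite -(ler_nat R) natrM; apply: le_trans m2.
    have c2 : c ^+ 2 <= delta / 4096.
      have cd : c * 4096 <= delta by rewrite -ck; clear -c0 k2; nra.
      by clear -c0 cd d1; nra.
    have : k%:R * d%:R <= c ^+ 2 * D / 16.
      apply: (@le_trans _ _ (k%:R * (c4 * D))); first by rewrite ler_wpM2l.
      by rewrite -c4k; clear; lra.
    by move/le_trans; apply; clear -c2 D0; nra.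
  - by rewrite -(ler_nat R); clear -kh k2; lra.
  - by rewrite mulnC leq_divM.
have n1 : (1 < n)%N by apply: leq_trans n8.
have size_bound : (2 * k ^ k.+2 * n.+1 * K.-1 ^ d < K ^ d)%N.
  by apply: (@size_estimate R) => //; rewrite -/L; clear -D3 dr; lra.
have uE : (n <= 4 * (n - 2)./2)%N by clear -n8; lia.
have uR : n%:R <= 4 * ((n - 2)./2)%:R :> R by rewrite -[4]/(4%:R) -natrM ler_nat.
have q0 : 0 < 1 - p by rewrite -(pmulr_rgt0 _ n0); clear -Bq k2; lra.
have p1 : p < 1 by rewrite -subr_gt0.
have rich_bound : prob p (fun G : sgraph T => ~~ [forall o, rich k m G (omit o)]) <= n%:R^-1.
  apply: le_trans (@prob_not_rich T R p k m (ltnW k1) _ _ _) _.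
  - by rewrite p0.
  - by move: kD; rewrite -/n /D; clear -uR p0; nra.
  - by rewrite -/n; clear -uR q0 Bq; nra.
  (* The union bound has at most n^3 terms, each at most n^-4. *)
  rewrite -/n -deltaE; apply: (@le_trans _ _ ((n ^ 3)%:R * n%:R ^- 4)).
    apply: ler_pM => //.
    - rewrite mulr_ge0 ?exprn_ge0 // subr_ge0; clear -p0 p1 d0 d1; nra.
    - by rewrite ler_nat !expnS expn0; clear -nk n8; nia.
    apply: le_trans (few_joined_estimate _ p01 (erefl _) uR m1) _.
      by rewrite d1 ltW.
    by rewrite -expRN_ln ?(ltnW n1) // ler_expR -/L -/D; clear -D1 L1; lra.
  by rewrite natrX [_ ^+ 4]exprSr invfM mulrA mulfV ?mul1r // expf_neq0 // gt_eqF.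
have sparse_bound : prob p (fun G : sgraph T => ~~ sparse m h G) <= 2 / n%:R.
  apply: le_trans (prob_not_sparse p01 m h) _; apply: sparse_estimate => //.
  by rewrite -/n -/L; clear -D1 m2; lra.
have dense_bound : prob p (fun G : sgraph T => ~~ dense h' (2 * k * d * n) G) <= n%:R^-1.
  apply: le_trans (prob_not_dense p01 h' _) _; apply: dense_estimate; first exact: ltnW.
  rewrite -/n !natrM.
  have hh : c ^+ 2 * D * n%:R <= p * (h'%:R * h'%:R).
    have -> : c ^+ 2 * D * n%:R = p * ((c * n%:R) * (c * n%:R)) by rewrite /D; ring.
    by rewrite ler_wpM2l ?(ltW p0) // ler_pM // mulr_ge0 ?(ltW c0) ?(ltW n0).
  have kd : k%:R * d%:R <= c ^+ 2 * D / 16.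
    apply: (@le_trans _ _ (k%:R * (c4 * D))); first by rewrite ler_wpM2l.
    by rewrite -c4k; clear; lra.
  have cD : 8 <= c ^+ 2 * D by clear -D2 L1; lra.
  have kdn : k%:R * d%:R * n%:R <= c ^+ 2 * D / 16 * n%:R by rewrite ler_wpM2r // ltW.
  have cDn : 8 * n%:R <= c ^+ 2 * D * n%:R by rewrite ler_wpM2r // ltW.
  by clear -hh kdn cDn; lra.
have good_bound : prob p (fun G : sgraph T => ~~ good k m d h h' G) <= 4 / n%:R.
  apply: (@le_trans _ _ (prob p (fun G : sgraph T => (~~ [forall o, rich k m G (omit o)] ||
      ~~ sparse m h G) || ~~ dense h' (2 * k * d * n) G))).
    by apply: prob_le => // G; rewrite !negb_and orbA.
  apply: le_trans (prob_or p01 _ _) _.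
  apply: le_trans (lerD (prob_or p01 _ _) (lexx _)) _.
  by clear -rich_bound sparse_bound dense_bound; lra.
apply: (@le_trans _ _ (prob p (good k m d h h' : pred (sgraph T)))).
  by rewrite lerBlDr addrC -lerBlDr -probC // .
apply: prob_le => // G goodG; apply/eqP.
exact: (good_chromatic_index k1 n1 goodG params zk K1 gap size_bound).
Qed.

(** * Passage to the limit *)

Local Open Scope classical_set_scope.

Lemma gnp_probE (R : realType) (n : nat) (p : R) (A : pred (sgraph 'I_n)) :
  gnp_prob p A = prob p A.
Proof.
rewrite /gnp_prob /prob /expect big_mkcond; apply: eq_bigr => G _.
by case: (A G); rewrite ?mulr1 ?mulr0.
Qed.

(** [M n] stands for [n], [2 * n] or [2 * n + 1], while [p] is taken at [n]. From [M n <= n ^ 2] the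
    logarithm at most doubles, hence the constant [2 * C]; the bound [3 <= n] is where
    [2 * n + 1 <= n ^ 2] begins to hold. *)
Lemma gnp_chromatic_index_cvg (R : realType) (k : nat) : (1 < k)%N ->
  exists C : R, 0 < C /\ forall (p : nat -> R) (M : nat -> nat),
    (forall n, 0 <= p n <= 1) ->
    (\forall n \near \oo, C * n%:R^-1 * ln n%:R <= p n) ->
    n%:R * (1 - p n) @[n --> \oo] --> +oo ->
    (forall n, n <= M n)%N -> (forall n, 3 <= n -> M n <= n ^ 2)%N ->
    gnp_prob (p n) (fun G : sgraph 'I_(M n) => mod_chromatic_index k G ==
       if ~~ odd k && odd (M n) then k.+1 else k) @[n --> \oo] --> (1 : R).
Proof.
move=> k1; have [C [B [N [C0 whp]]]] := whp_chromatic_index R k1.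
exists (2 * C); split; first by rewrite mulr_gt0.
move=> p M p01 Cp qB nM Mn; apply/cvgrPdist_le => e e0.
have /cvgryPge/(_ B) Bq := qB.
near=> n.
have n3 : (3 <= n)%N by near: n; exact: nbhs_infty_ge.
have NM : (N <= #|'I_(M n)|)%N.
  rewrite card_ord; apply: leq_trans (nM n); near: n; exact: nbhs_infty_ge.
have n0 : 0 < n%:R :> R by rewrite ltr0n (leq_trans _ n3).
have nMR : n%:R <= (M n)%:R :> R by rewrite ler_nat.
have /andP[p0 p1] := p01 n.
have /(_ _ _) := whp 'I_(M n) (p n) NM (p01 n); rewrite card_ord => /(_ _ _).
have Cn : 2 * C * ln (n%:R : R) <= n%:R * p n.
  have : 2 * C * n%:R^-1 * ln (n%:R : R) <= p n by near: n.
  rewrite -(ler_pM2l n0); apply: le_trans; rewrite le_eqVlt; apply/orP; left.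
  by apply/eqP; field; rewrite gt_eqF.
have CM : C * ln (M n)%:R <= (M n)%:R * p n.
  apply: (@le_trans _ _ (n%:R * p n)); last by rewrite ler_wpM2r.
  apply: le_trans Cn; rewrite [2 * C]mulrC -mulrA ler_pM2l // mulr_natl -lnXn //.
  rewrite ler_ln ?posrE ?exprn_gt0 ?(lt_le_trans n0) //.
  by rewrite -natrX ler_nat Mn.
have BM : B <= (M n)%:R * (1 - p n).
  apply: (@le_trans _ _ (n%:R * (1 - p n))); first by near: n.
  by rewrite ler_wpM2r // subr_ge0.
move=> /(_ CM BM) ge1; rewrite gnp_probE.
set P := prob _ _ in ge1 *.
have P1 : P <= 1.
  rewrite -[leRHS](@expect_cst _ (edge 'I_(M n)) (p n)); apply: le_expect => // G.
  by rewrite lern1 leq_b1.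
rewrite ger0_norm ?subr_ge0 //.
have : 4 / e <= n%:R by near: n; exact: nbhs_infty_ger.
rewrite ler_pdivrMr // => en.
have : 4 / (M n)%:R <= e.
  rewrite ler_pdivrMr ?(lt_le_trans n0) // mulrC; apply: le_trans en _.
  by rewrite ler_wpM2r // ltW.
by lra.
Unshelve. all: by end_near. Qed.

Theorem theorem1p1 (R : realType) (k : nat) (hk : (2 <= k)%N) :
  exists C : R, 0 < C /\
    forall p : nat -> R,
      (forall n, 0 <= p n <= 1) ->
      (\forall n \near \oo, C * n%:R^-1 * ln n%:R <= p n) ->
      n%:R * (1 - p n) @[n --> \oo] --> +oo ->
      (~~ odd k ->
         gnp_prob (p n) (fun G : sgraph 'I_(2 * n) =>
           mod_chromatic_index k G == k) @[n --> \oo] --> (1 : R) /\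
         gnp_prob (p n) (fun G : sgraph 'I_(2 * n + 1) =>
           mod_chromatic_index k G == k.+1) @[n --> \oo] --> (1 : R)) /\
      (odd k ->
         gnp_prob (p n) (fun G : sgraph 'I_n =>
           mod_chromatic_index k G == k) @[n --> \oo] --> (1 : R)).
Proof.
have [C [C0 cvgC]] := gnp_chromatic_index_cvg R hk.
exists C; split=> // p p01 Cp qoo.
split=> [ek | ok].
  split.
    have := cvgC p (fun n => 2 * n)%N p01 Cp qoo.
    under eq_fun do rewrite ek oddM /=.
    by apply=> n; rewrite ?leq_pmull // -mulnn => n3; rewrite leq_mul2r (ltnW n3) orbT.
  have := cvgC p (fun n => 2 * n + 1)%N p01 Cp qoo.
  under eq_fun do rewrite ek oddD oddM /=.
  by apply=> n; [lia|rewrite -mulnn; nia].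
have := cvgC p id p01 Cp qoo; rewrite ok /=.
by apply=> // n n3; rewrite -mulnn leq_pmulr // (leq_trans _ n3).
Qed.
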